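(* Let $f\not\equiv 0$ be a weakly holomorphic modular function for $\mathrm{SL}(2,\mathbb{Z})$ such that $f(e^{it})$ is real and non-negative for all $t\in[\pi/3,2\pi/3]$. Then the limit superior \[\Lambda_f(x)=\limsup_{n\to\infty}\frac{\mathrm{Re}(I_f(A_n))}{n}\] is finite for every $x\in(0,\infty)$, and $\Lambda_f$ extends to a function $\Lambda_f:\mathbb{P}^1(\mathbb{R})\to\mathbb{R}$ satisfying \[\Lambda_f\Big(\frac{ax+b}{cx+d}\Big)=\Lambda_f(x)\quad\text{for all }x\in\mathbb{P}^1(\mathbb{R})\text{ and all }\begin{pmatrix}a&b\\c&d\end{pmatrix}\in\mathrm{GL}(2,\mathbb{Z}).\] Moreover, $\Lambda_f(x)=0$ for all $x\in\mathbb{P}^1(\mathbb{Q})$.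
   Context: Let $T=\begin{pmatrix}1&1\\0&1\end{pmatrix}$, $V=\begin{pmatrix}1&0\\1&1\end{pmatrix}$; matrices act on $\mathbb{H}$ and on $\mathbb{P}^1(\mathbb{R})$ by Möbius transformations. A weakly holomorphic modular function for $\mathrm{SL}(2,\mathbb{Z})$ is a holomorphic $\mathrm{SL}(2,\mathbb{Z})$-invariant function on $\mathbb{H}$ that is meromorphic at the cusp. For a hyperbolic $A\in\mathrm{SL}(2,\mathbb{Z})$ let $w$ and $\tilde w$ be its repelling and attracting fixed points in $\mathbb{R}$, let $Q(x,y)=ax^2+bxy+cy^2$ be the primitive integral quadratic form with $Q(w,1)=Q(\tilde w,1)=0$, with sign chosen so that $\mathrm{sgn}(a)=\mathrm{sgn}(w-\tilde w)$, and $D=b^2-4ac$. Define $I_f(A)=\int_{\tau_0}^{A\tau_0}\frac{f(\tau)\sqrt{D}}{Q(\tau,1)}d\tau$ (independent of $\tau_0\in\mathbb{H}$), and $I_f(A)=0$ if $A$ is not hyperbolic. For $x\in(0,\infty)$, the associated sequence $(A_n)_{n\ge0}$ in $\mathrm{SL}(2,\mathbb{Z}_{\ge0})$ (coming from the path in the Farey tree generated from $0/1,1/0$ by mediants converging to $x$) is the unique sequence with $A_0=I$, $A_n^{-1}A_{n+1}\in\{T,V\}$ for all $n$, $A_n(1)\to x$, and such that the letters $A_n^{-1}A_{n+1}$ include infinitely many $T$'s and $V$'s if $x$ is irrational, and are eventually all equal to $V$ if $x$ is rational. Explicitly, for irrational $x=[a_1;a_2,\ldots]$ ($a_1\ge0$,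 $a_i\ge1$ for $i\ge2$): $A_n=T^n$ for $0\le n\le a_1$; $A_n=T^{a_1}V^{a_2}\cdots V^{a_i}T^k$ if $n=a_1+\dots+a_i+k$, $0\le k\le a_{i+1}$, $i$ even; $A_n=T^{a_1}V^{a_2}\cdots T^{a_i}V^k$ if $n=a_1+\dots+a_i+k$, $0\le k\le a_{i+1}$, $i$ odd. *)

(* Defs.v *)
From Stdlib Require Import Reals ZArith QArith Qreals ClassicalEpsilon.
From Coquelicot Require Import Coquelicot.
Open Scope R_scope.

(** * Integral 2 x 2 matrices *)

Record mat2 : Type := Mat2 { m11 : Z; m12 : Z; m21 : Z; m22 : Z }.

Definition mat_id : mat2 := Mat2 1 0 0 1.
Definition mat_T : mat2 := Mat2 1 1 0 1.
Definition mat_V : mat2 := Mat2 1 0 1 1.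

Definition mat_mul (A B : mat2) : mat2 :=
  Mat2 (m11 A * m11 B + m12 A * m21 B) (m11 A * m12 B + m12 A * m22 B)
       (m21 A * m11 B + m22 A * m21 B) (m21 A * m12 B + m22 A * m22 B).

Definition mat_det (A : mat2) : Z := (m11 A * m22 A - m12 A * m21 A)%Z.
Definition mat_tr (A : mat2) : Z := (m11 A + m22 A)%Z.

Definition SL2Z (A : mat2) : Prop := mat_det A = 1%Z.
Definition GL2Z (A : mat2) : Prop := mat_det A = 1%Z \/ mat_det A = (-1)%Z.

Definition hyperbolic (A : mat2) : Prop := SL2Z A /\ (2 < Z.abs (mat_tr A))%Z.

(** * Moebius action on the upper half plane and on the real projective line *)

Definition upper_half_plane (z : C) : Prop := 0 < Im z.

Definition Zc (n : Z) : C := RtoC (IZR n).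

Definition moebius_C (A : mat2) (z : C) : C :=
  ((Zc (m11 A) * z + Zc (m12 A)) / (Zc (m21 A) * z + Zc (m22 A)))%C.

(* Meaningful only where the denominator does not vanish. *)
Definition moebius_R (A : mat2) (x : R) : R :=
  (IZR (m11 A) * x + IZR (m12 A)) / (IZR (m21 A) * x + IZR (m22 A)).

Inductive P1R : Type :=
  | P1_fin (x : R)
  | P1_inf.

Definition moebius_P1 (A : mat2) (p : P1R) : P1R :=
  match p with
  | P1_fin x =>
      if Req_EM_T (IZR (m21 A) * x + IZR (m22 A)) 0
      then P1_inf else P1_fin (moebius_R A x)
  | P1_inf =>
      if Req_EM_T (IZR (m21 A)) 0
      then P1_inf else P1_fin (IZR (m11 A) / IZR (m21 A))
  end.

Definition rational (x : R) : Prop := exists q : Q, x = Q2R q.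

Definition P1_rational (p : P1R) : Prop :=
  match p with
  | P1_fin x => rational x
  | P1_inf => True
  end.

(** * Weakly holomorphic modular functions *)

Definition C_exp (z : C) : C :=
  (exp (Re z) * cos (Im z), exp (Re z) * sin (Im z)).

Definition nome (tau : C) : C := C_exp (RtoC (2 * PI) * Ci * tau)%C.

Definition holomorphic_on (U : C -> Prop) (f : C -> C) : Prop :=
  forall z : C, U z -> @ex_derive C_AbsRing C_NormedModule f z.

(* The Fourier expansion of [f] in [q = exp(2 pi i tau)] has only finitely many
   negative powers: [q ^ N * f tau] is a power series in [q]. *)
Definition meromorphic_at_cusp (f : C -> C) : Prop :=
  exists (N : nat) (a : nat -> C),
    forall tau : C, upper_half_plane tau ->
      @is_pseries C_AbsRing C_NormedModule a (nome tau)
        (Cmult (@pow_n C_AbsRing (nome tau) N) (f tau)).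

(* Only the values of [f] on the upper half plane matter. *)
Definition weakly_holomorphic_modular (f : C -> C) : Prop :=
  holomorphic_on upper_half_plane f /\
  (forall (A : mat2) (tau : C), SL2Z A -> upper_half_plane tau ->
     f (moebius_C A tau) = f tau) /\
  meromorphic_at_cusp f.

(** * Cycle integrals *)

Definition attracting_fixed_point (A : mat2) (w : R) : Prop :=
  moebius_P1 A (P1_fin w) = P1_fin w /\ Rabs (Derive (moebius_R A) w) < 1.

Definition repelling_fixed_point (A : mat2) (w : R) : Prop :=
  moebius_P1 A (P1_fin w) = P1_fin w /\ 1 < Rabs (Derive (moebius_R A) w).

(* The form [a x ^ 2 + b x y + c y ^ 2]. *)
Record qform : Type := QForm { qa : Z; qb : Z; qc : Z }.

Definition primitive_form (Q : qform) : Prop :=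
  Z.gcd (Z.gcd (qa Q) (qb Q)) (qc Q) = 1%Z.

Definition qdisc (Q : qform) : Z := (qb Q * qb Q - 4 * qa Q * qc Q)%Z.

Definition qform_R (Q : qform) (x y : R) : R :=
  IZR (qa Q) * x ^ 2 + IZR (qb Q) * x * y + IZR (qc Q) * y ^ 2.

Definition qform_C (Q : qform) (x y : C) : C :=
  (Zc (qa Q) * (x * x) + Zc (qb Q) * (x * y) + Zc (qc Q) * (y * y))%C.

Definition is_form_of (A : mat2) (Q : qform) : Prop :=
  exists w w' : R,
    repelling_fixed_point A w /\ attracting_fixed_point A w' /\
    primitive_form Q /\ qform_R Q w 1 = 0 /\ qform_R Q w' 1 = 0 /\
    sign (IZR (qa Q)) = sign (w - w').

(* Such a form exists and is unique when [A] is hyperbolic. *)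
Definition form_of (A : mat2) : qform :=
  epsilon (inhabits (QForm 0 0 0)) (is_form_of A).

Definition segment_integral (g : C -> C) (z1 z2 : C) : C :=
  @RInt C_R_CompleteNormedModule
    (fun s : R => Cmult (g (z1 + RtoC s * (z2 - z1))%C) (z2 - z1)%C) 0 1.

(* The integral runs along the segment from [tau0] to [A tau0], which stays in
   the upper half plane.  For [f] a weakly holomorphic modular function its
   value does not depend on the base point [tau0] of the upper half plane. *)
Definition cycle_integral (f : C -> C) (tau0 : C) (A : mat2) : C :=
  if excluded_middle_informative (hyperbolic A) then
    let Q := form_of A in
    segment_integral
      (fun tau => (f tau * RtoC (sqrt (IZR (qdisc Q))) / qform_C Q tau (RtoC 1))%C)
      tau0 (moebius_C A tau0)
  else RtoC 0.

(** * Sequences associated with positive reals *)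

Definition is_farey_sequence (x : R) (A : nat -> mat2) : Prop :=
  A 0%nat = mat_id /\
  (forall n : nat, A (S n) = mat_mul (A n) mat_T \/ A (S n) = mat_mul (A n) mat_V) /\
  is_lim_seq (fun n => moebius_R (A n) 1) x /\
  (~ rational x ->
     (forall N : nat, exists n : nat, (N <= n)%nat /\ A (S n) = mat_mul (A n) mat_T) /\
     (forall N : nat, exists n : nat, (N <= n)%nat /\ A (S n) = mat_mul (A n) mat_V)) /\
  (rational x ->
     exists N : nat, forall n : nat, (N <= n)%nat -> A (S n) = mat_mul (A n) mat_V).

(* Such a sequence exists and is unique when [0 < x]. *)
Definition farey_sequence (x : R) : nat -> mat2 :=
  epsilon (inhabits (fun _ : nat => mat_id)) (is_farey_sequence x).

Definition limsup_cycle_integral (f : C -> C) (tau0 : C) (x : R) : Rbar :=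
  LimSup_seq (fun n => Re (cycle_integral f tau0 (farey_sequence x n)) / INR n).

(* Main.v *)
(* The matrices T and V both send exp(2 pi i / 3) to exp(pi i / 3).  Splitting the period of a
   word A in T and V at the points A_k exp(2 pi i / 3), A_k running through the prefixes of A, and
   moving each piece back by A_k, turns the real part of I_f(A) into the sum of phi(A_k^-1 w') and
   psi(- A_k^-1 w) over k, where w < 0 < w' are the fixed points of A and phi, psi are integrals of
   f against nonnegative bounded kernels along the arc.  The functions phi and psi are Lipschitz
   on [0, oo] and a Farey interval of level m has length O(1/m), so replacing the fixed points by
   arbitrary positive points changes the sum over n letters by O(1 + 1/2 + ... + 1/n).  The sum
   is therefore, up to o(n), a function of the word alone; it is changed by O(sqrt n) when a letter
   is prepended and is invariant under exchanging T and V because phi(1/x) = phi(x), which gives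
   the invariance under x -> x + 1 and x -> 1/x.  On a tail of V's the sum grows like a harmonic
   series.  Independence of paths and base points needs only that f is complex differentiable:
   Goursat's argument on rectangles provides a primitive of the real part of the form. *)
Require Import Defs.
From Stdlib Require Import Reals ZArith Lia Lra List Qreals.
From Stdlib Require Import ClassicalEpsilon FunctionalExtensionality.
From Coquelicot Require Import Coquelicot.
Import ListNotations.
Open Scope R_scope.

(** * Words in T and V *)

(** On the upper half plane sqrt D / Q(z,1) equals 1/(z - w) - 1/(z - w'), and Re (i z / (z - r)) =
    r sin t / |z - r|^2 at z = exp(i t). A real value of f on the arc factors out, and the opposite
    signs of w and w' make both contributions nonnegative. Because |cos t| <= 1/2 on the arc, the
    denominators are comparable to (1 + |r|)^2; this is the source of the boundedness and of the
    Lipschitz property up to infinity. The point chosen to replace the fixed points is 1, because x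
    -> 1/x fixes it. The harmonic error is weakened to sqrt n, which telescopes without logarithms
    and is still o(n). GL(2,Z) contains x -> -x, so the exponent at x is taken at |x|. Translation
    by 1 does not respect |x| on (-1, 0); there 1 - y has to be compared with y, by inversions and
    translations of positive numbers. Rationals are kept apart: the orbit of a positive rational
    meets the point 1 common to both Farey branches, where the exchange of T and V fails. *)

(* A letter is [true] for [T] and [false] for [V]. *)
Definition letter_mat (s : bool) : mat2 := if s then mat_T else mat_V.
Definition letter_act (s : bool) (x : R) : R := if s then x + 1 else x / (x + 1).
Definition word_mat (l : list bool) : mat2 := fold_right (fun s => mat_mul (letter_mat s)) mat_id l.
Definition word_act (l : list bool) (x : R) : R := fold_right letter_act x l.

Lemma mat_mul_assoc A B C : mat_mul A (mat_mul B C) = mat_mul (mat_mul A B) C.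
Proof. unfold mat_mul. cbn [m11 m12 m21 m22]. f_equal; ring. Qed.

Lemma mat_mul_id_l A : mat_mul mat_id A = A.
Proof. destruct A as [a b c d]. unfold mat_mul, mat_id. cbn [m11 m12 m21 m22]. f_equal; ring. Qed.

Lemma mat_mul_id_r A : mat_mul A mat_id = A.
Proof. destruct A as [a b c d]. unfold mat_mul, mat_id. cbn [m11 m12 m21 m22]. f_equal; ring. Qed.

Lemma mat_det_mul A B : mat_det (mat_mul A B) = (mat_det A * mat_det B)%Z.
Proof. unfold mat_det, mat_mul; simpl; ring. Qed.

Lemma SL2Z_mul A B : SL2Z A -> SL2Z B -> SL2Z (mat_mul A B).
Proof. unfold SL2Z. rewrite mat_det_mul. intros -> ->. reflexivity. Qed.

Lemma SL2Z_letter s : SL2Z (letter_mat s).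
Proof. destruct s; reflexivity. Qed.

Lemma SL2Z_word l : SL2Z (word_mat l).
Proof. induction l as [|s l IH]; [reflexivity|]. apply SL2Z_mul; trivial. apply SL2Z_letter. Qed.

Lemma word_mat_app l l' : word_mat (l ++ l') = mat_mul (word_mat l) (word_mat l').
Proof.
  induction l as [|s l IH]; simpl.
  - now rewrite mat_mul_id_l.
  - rewrite <- mat_mul_assoc. now f_equal.
Qed.

Lemma word_act_app l l' x : word_act (l ++ l') x = word_act l (word_act l' x).
Proof. apply fold_right_app. Qed.

(** The sum of the entries starts at 2 for the identity. Left multiplication by a letter adds one
    row to the other, and each row contains a diagonal entry that is at least 1, so the sum grows by
    at least 1 per letter. *)
Lemma word_mat_entries l :
  let A := word_mat l in
  (1 <= m11 A /\ 0 <= m12 A /\ 0 <= m21 A /\ 1 <= m22 A /\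
   Z.of_nat (length l) + 2 <= m11 A + m12 A + m21 A + m22 A)%Z.
Proof.
  cbv zeta. induction l as [|s l IH]; [cbn; lia|].
  destruct s; cbn [word_mat fold_right letter_mat length]; fold (word_mat l);
    unfold mat_mul, mat_T, mat_V; cbn [m11 m12 m21 m22]; lia.
Qed.

Lemma word_mat_T_in l : In true l -> (1 <= m12 (word_mat l))%Z.
Proof.
  induction l as [|s l IH]; [intros []|].
  assert (H := word_mat_entries l). cbv zeta in H.
  intros [-> | Hin]; [|specialize (IH Hin)]; [|destruct s];
    cbn [word_mat fold_right letter_mat length]; fold (word_mat l);
    unfold mat_mul, mat_T, mat_V; cbn [m11 m12 m21 m22]; lia.
Qed.

Lemma word_mat_V_in l : In false l -> (1 <= m21 (word_mat l))%Z.
Proof.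
  induction l as [|s l IH]; [intros []|].
  assert (H := word_mat_entries l). cbv zeta in H.
  intros [-> | Hin]; [|specialize (IH Hin)]; [|destruct s];
    cbn [word_mat fold_right letter_mat length]; fold (word_mat l);
    unfold mat_mul, mat_T, mat_V; cbn [m11 m12 m21 m22]; lia.
Qed.

(** With all entries positive, a d = 1 + b c is at least 2, so the trace a + d is at least 3. *)
Lemma hyperbolic_word l : In true l -> In false l -> hyperbolic (word_mat l).
Proof.
  intros HT HV. apply word_mat_T_in in HT. apply word_mat_V_in in HV.
  assert (H := word_mat_entries l). cbv zeta in H.
  assert (D := SL2Z_word l). split; trivial.
  unfold SL2Z, mat_det in D. unfold mat_tr. nia.
Qed.

Lemma letter_act_ge0 s x : 0 <= x -> 0 <= letter_act s x.
Proof. intros H. destruct s; simpl; [lra|]. apply Rdiv_le_0_compat; lra. Qed.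

Lemma letter_act_gt0 s x : 0 < x -> 0 < letter_act s x.
Proof. intros H. destruct s; simpl; [lra|]. apply Rdiv_lt_0_compat; lra. Qed.

Lemma word_act_ge0 l x : 0 <= x -> 0 <= word_act l x.
Proof. induction l; simpl; trivial. intros H. now apply letter_act_ge0, IHl. Qed.

Lemma word_act_gt0 l x : 0 < x -> 0 < word_act l x.
Proof. induction l; simpl; trivial. intros H. now apply letter_act_gt0, IHl. Qed.

Lemma word_mat_entries_R l :
  1 <= IZR (m11 (word_mat l)) /\ 0 <= IZR (m12 (word_mat l)) /\
  0 <= IZR (m21 (word_mat l)) /\ 1 <= IZR (m22 (word_mat l)) /\
  INR (length l) + 2 <= IZR (m11 (word_mat l)) + IZR (m12 (word_mat l))
    + IZR (m21 (word_mat l)) + IZR (m22 (word_mat l)) /\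
  IZR (m11 (word_mat l)) * IZR (m22 (word_mat l))
    - IZR (m12 (word_mat l)) * IZR (m21 (word_mat l)) = 1.
Proof.
  destruct (word_mat_entries l) as (H1 & H2 & H3 & H4 & H5).
  apply IZR_le in H1, H2, H3, H4, H5. rewrite !plus_IZR, <- INR_IZR_INZ in H5.
  repeat split; trivial. rewrite <- !mult_IZR, <- minus_IZR.
  apply (f_equal IZR (SL2Z_word l)).
Qed.

Lemma word_actE l x : 0 <= x -> word_act l x = moebius_R (word_mat l) x.
Proof.
  intros Hx. induction l as [|s l IH].
  - unfold moebius_R; simpl. field.
  - cbn [word_act fold_right]. fold (word_act l x). rewrite IH.
    destruct (word_mat_entries_R l) as (H1 & H2 & H3 & H4 & _).
    assert (0 < IZR (m21 (word_mat l)) * x + IZR (m22 (word_mat l))) by nra.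
    assert (0 <= IZR (m11 (word_mat l)) * x + IZR (m12 (word_mat l))) by nra.
    unfold moebius_R. destruct s; cbn [word_mat fold_right letter_mat letter_act]; fold (word_mat l);
      unfold mat_mul, mat_T, mat_V; cbn [m11 m12 m21 m22];
      rewrite ?plus_IZR, ?mult_IZR; field; repeat split; nra.
Qed.

(* In the coordinate [x / (1 + x)] the Farey interval [word_act l (0, oo)] has length
   [1 / (p q)] with [p + q >= length l + 2]. *)
Lemma word_act_contraction l x y : 0 <= x -> 0 <= y ->
  Rabs (word_act l x - word_act l y) * (INR (length l) + 1)
    <= (1 + word_act l x) * (1 + word_act l y).
Proof.
  intros Hx Hy. rewrite !word_actE by trivial. unfold moebius_R.
  destruct (word_mat_entries_R l) as (H1 & H2 & H3 & H4 & H5 & H6).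
  set (a := IZR (m11 (word_mat l))) in *. set (b := IZR (m12 (word_mat l))) in *.
  set (c := IZR (m21 (word_mat l))) in *. set (d := IZR (m22 (word_mat l))) in *.
  set (n := INR (length l)) in *.
  assert (Dx : 0 < c * x + d) by nra. assert (Dy : 0 < c * y + d) by nra.
  replace ((a * x + b) / (c * x + d) - (a * y + b) / (c * y + d)) with
    ((x - y) / ((c * x + d) * (c * y + d))).
  2:{ replace (x - y) with ((a * d - b * c) * (x - y)) by (rewrite H6; ring). field; lra. }
  replace ((1 + (a * x + b) / (c * x + d)) * (1 + (a * y + b) / (c * y + d))) with
    ((((a + c) * x + (b + d)) * ((a + c) * y + (b + d))) / ((c * x + d) * (c * y + d))) by (field; lra).
  assert (DD : 0 < (c * x + d) * (c * y + d)) by now apply Rmult_lt_0_compat.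
  unfold Rdiv at 1. rewrite Rabs_mult, Rabs_inv, (Rabs_pos_eq _ (Rlt_le _ _ DD)).
  replace (Rabs (x - y) * / ((c * x + d) * (c * y + d)) * (n + 1)) with
    (Rabs (x - y) * (n + 1) / ((c * x + d) * (c * y + d))) by (field; lra).
  apply Rmult_le_compat_r; [now apply Rlt_le, Rinv_0_lt_compat|].
  set (p := a + c). set (q := b + d).
  assert (Hp : 1 <= p) by (unfold p; lra). assert (Hq : 1 <= q) by (unfold q; lra).
  (* From (p - 1)(q - 1) >= 0 one gets p q >= p + q - 1, and p + q is the sum of all entries. *)
  assert (Hpq : n + 1 <= p * q) by (assert (0 <= (p - 1) * (q - 1)) by nra; unfold p, q in *; nra).
  apply Rle_trans with (Rabs (x - y) * (p * q)).
  { apply Rmult_le_compat_l; [apply Rabs_pos|exact Hpq]. }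
  assert (Rabs (x - y) <= x + y) by (apply Rabs_le; lra).
  apply Rle_trans with ((x + y) * (p * q)); [apply Rmult_le_compat_r; nra|].
  assert (0 <= p * x * (p * y)) by (apply Rmult_le_pos; apply Rmult_le_pos; lra).
  nra.
Qed.

(** * The Farey path of a positive real *)

Definition prefix (s : nat -> bool) (n : nat) : list bool := map s (seq 0 n).

Lemma prefix_S s n : prefix s (S n) = prefix s n ++ [s n].
Proof. unfold prefix. now rewrite seq_S, map_app. Qed.

Lemma length_prefix s n : length (prefix s n) = n.
Proof. unfold prefix. now rewrite length_map, length_seq. Qed.

Lemma prefix_add s n k : prefix s (n + k) = prefix s n ++ prefix (fun i => s (n + i)%nat) k.
Proof.
  induction k as [|k IH].
  - rewrite Nat.add_0_r. unfold prefix at 3. simpl. now rewrite app_nil_r.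
  - rewrite Nat.add_succ_r, !prefix_S, IH, app_assoc. reflexivity.
Qed.

Lemma In_prefix s n i : (i < n)%nat -> In (s i) (prefix s n).
Proof. intros H. apply in_map, in_seq. lia. Qed.

(** The slow continued fraction map: its branches invert [T] on [1, oo) and [V] on [0, 1). At 1 the
    [T] branch is taken, so that 1 goes to 0, which the [V] branch fixes; this is what makes the
    letters of a rational end in [V]. *)
Definition farey_map (y : R) : R := if Rle_dec 1 y then y - 1 else y / (1 - y).
Definition farey_orbit (x : R) (n : nat) : R := Nat.iter n farey_map x.
Definition farey_letter (x : R) (n : nat) : bool := if Rle_dec 1 (farey_orbit x n) then true else false.
Definition farey_word (x : R) (n : nat) : list bool := prefix (farey_letter x) n.

Lemma farey_orbit_ge0 x n : 0 <= x -> 0 <= farey_orbit x n.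
Proof.
  intros Hx. induction n as [|n IH]; simpl; trivial.
  unfold farey_map. destruct (Rle_dec 1 _); [simpl in *; lra|].
  apply Rdiv_le_0_compat; simpl in *; lra.
Qed.

Lemma letter_act_farey_letter x n : letter_act (farey_letter x n) (farey_orbit x (S n)) = farey_orbit x n.
Proof.
  simpl. fold (farey_orbit x n). unfold farey_letter, farey_map. destruct (Rle_dec 1 _); simpl.
  - ring.
  - field. split; lra.
Qed.

Lemma word_act_farey_word x n : word_act (farey_word x n) (farey_orbit x n) = x.
Proof.
  induction n as [|n IH]; trivial. unfold farey_word in *.
  rewrite prefix_S, word_act_app. cbn [word_act fold_right].
  now rewrite letter_act_farey_letter.
Qed.

(** * Rationality along Farey orbits *)

Lemma rational_IZR z : rational (IZR z).
Proof. exists (inject_Z z). unfold Q2R; simpl. field. Qed.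

Lemma rational_plus x y : rational x -> rational y -> rational (x + y).
Proof. intros [p ->] [q ->]. exists (p + q)%Q. now rewrite Q2R_plus. Qed.

Lemma rational_mult x y : rational x -> rational y -> rational (x * y).
Proof. intros [p ->] [q ->]. exists (p * q)%Q. now rewrite Q2R_mult. Qed.

Lemma rational_inv x : rational x -> rational (/ x).
Proof.
  intros [p ->]. destruct (Qeq_dec p 0) as [H|H].
  - apply Qeq_eqR in H. rewrite H. unfold Q2R at 1. simpl. rewrite Rmult_0_l, Rinv_0.
    apply (rational_IZR 0).
  - exists (/ p)%Q. now rewrite Q2R_inv.
Qed.

Lemma rational_opp x : rational x -> rational (- x).
Proof. intros [p ->]. exists (- p)%Q. now rewrite Q2R_opp. Qed.

Lemma rational_minus x y : rational x -> rational y -> rational (x - y).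
Proof. intros Hx Hy. apply rational_plus; trivial. now apply rational_opp. Qed.

Lemma rational_div x y : rational x -> rational y -> rational (x / y).
Proof. intros Hx Hy. apply rational_mult; trivial. now apply rational_inv. Qed.

Lemma rational_letter_act s x : rational x -> rational (letter_act s x).
Proof.
  intros H. assert (H1 := rational_plus x 1 H (rational_IZR 1)).
  destruct s; simpl; trivial. now apply rational_div.
Qed.

Lemma rational_word_act l x : rational x -> rational (word_act l x).
Proof. induction l; simpl; trivial. intros H. now apply rational_letter_act, IHl. Qed.

Lemma farey_orbit_irrational x n : ~ rational x -> ~ rational (farey_orbit x n).
Proof.
  intros Hx H. apply Hx. rewrite <- (word_act_farey_word x n). now apply rational_word_act.
Qed.

Lemma farey_orbit_gt0 x n : ~ rational x -> 0 <= x -> 0 < farey_orbit x n.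
Proof.
  intros Hx Hx0. destruct (farey_orbit_ge0 x n Hx0) as [H|H]; trivial.
  exfalso. apply (farey_orbit_irrational x n Hx). rewrite <- H. apply (rational_IZR 0).
Qed.

Lemma word_act_lim (s : nat -> bool) (x : R) :
  (forall n, exists y, 0 <= y /\ word_act (prefix s n) y = x) ->
  is_lim_seq (fun n => word_act (prefix s n) 1) x.
Proof.
  intros H.
  assert (Hx : 0 <= x) by (destruct (H 0%nat) as (y & Hy & <-); exact Hy).
  apply is_lim_seq_spec. intros eps.
  (* The contraction bound involves (1 + u)(1 + x), u being the image of 1. Once n + 1 >= 2(1 + x)
     it forces u <= 2x + 1, and then (1 + u)(1 + x) <= K. *)
  set (K := 2 * (1 + x) * (1 + x)).
  assert (HK : 0 < K) by (unfold K; nra).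
  destruct (archimed_cor1 (eps / K)) as (N & HN & HN0).
  { apply Rdiv_lt_0_compat; [apply cond_pos|trivial]. }
  destruct (nfloor_ex (2 * (1 + x))) as [N' HN']; [lra|].
  exists (N + N')%nat. intros n Hn.
  destruct (H n) as (y & Hy & Hyx).
  assert (C0 := word_act_contraction (prefix s n) 1 y ltac:(lra) Hy).
  rewrite Hyx, length_prefix in C0.
  assert (Hu := word_act_ge0 (prefix s n) 1 ltac:(lra)).
  set (u := word_act (prefix s n) 1) in *.
  assert (Hn1 : INR N + INR N' <= INR n) by (rewrite <- plus_INR; now apply le_INR).
  assert (HNp : 0 < INR N) by (apply lt_0_INR; lia).
  assert (Hn2 : 2 * (1 + x) <= INR n + 1) by lra.
  assert (Hn3 : K < eps * (INR n + 1)).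
  { apply (Rmult_lt_compat_r (INR N * K)) in HN; [|nra].
    replace (/ INR N * (INR N * K)) with K in HN by (field; lra).
    replace (eps / K * (INR N * K)) with (eps * INR N) in HN by (field; lra).
    assert (0 < eps) by apply cond_pos. generalize (pos_INR N'). nra. }
  set (m := INR n + 1) in *.
  assert (Hbd : u <= 2 * x + 1).
  { assert (u - x <= Rabs (u - x)) by apply Rle_abs.
    assert ((u - x) * m <= (1 + u) * (1 + x)) by nra.
    assert (0 <= m) by lra.
    destruct (Rle_lt_dec u (2 * x + 1)); trivial. exfalso.
    assert ((u - x) * (2 * (1 + x)) <= (u - x) * m) by (apply Rmult_le_compat_l; lra).
    nra. }
  apply Rmult_lt_reg_r with m; [lra|].
  eapply Rle_lt_trans; [exact C0|]. eapply Rle_lt_trans; [|exact Hn3].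
  unfold K. nra.
Qed.

Lemma farey_word_lim x : 0 <= x -> is_lim_seq (fun n => word_act (farey_word x n) 1) x.
Proof.
  intros Hx. apply word_act_lim. intros n. exists (farey_orbit x n). split.
  - now apply farey_orbit_ge0.
  - apply word_act_farey_word.
Qed.

Lemma farey_orbit_add x n k : farey_orbit x (n + k) = farey_orbit (farey_orbit x n) k.
Proof. unfold farey_orbit. rewrite Nat.add_comm. apply Nat.iter_add. Qed.

(** A step through the [V] branch lowers 1 / y by exactly 1, so an unbroken run of [V]'s would make
    1 / y negative. *)
Lemma farey_letter_true_often x : 0 <= x -> ~ rational x ->
  forall N, exists n, (N <= n)%nat /\ farey_letter x n = true.
Proof.
  intros Hx Hr N. apply NNPP. intros Hn.
  assert (Hall : forall k, / farey_orbit x (N + k) = / farey_orbit x N - INR k).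
  { induction k as [|k IH]; [simpl; rewrite Nat.add_0_r; ring|].
    rewrite Nat.add_succ_r, S_INR. simpl. fold (farey_orbit x (N + k)).
    assert (H0 := farey_orbit_gt0 x (N + k) Hr Hx).
    unfold farey_map. destruct (Rle_dec 1 _) as [H1|H1].
    - exfalso. apply Hn. exists (N + k)%nat. split; [lia|].
      unfold farey_letter. destruct (Rle_dec 1 _); tauto.
    - replace (/ farey_orbit x N - (INR k + 1)) with
        (/ farey_orbit x (N + k) - 1) by lra. field. lra. }
  destruct (nfloor_ex (/ farey_orbit x N)) as [k Hk].
  { apply Rlt_le, Rinv_0_lt_compat, farey_orbit_gt0; trivial. }
  specialize (Hall (S k)). rewrite S_INR in Hall.
  assert (H0 := Rinv_0_lt_compat _ (farey_orbit_gt0 x (N + S k) Hr Hx)). lra.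
Qed.

(** A step through the [T] branch lowers y by 1, which cannot go on while y stays nonnegative. *)
Lemma farey_letter_false_often x : 0 <= x -> ~ rational x ->
  forall N, exists n, (N <= n)%nat /\ farey_letter x n = false.
Proof.
  intros Hx Hr N. apply NNPP. intros Hn.
  assert (Hall : forall k, farey_orbit x (N + k) = farey_orbit x N - INR k).
  { induction k as [|k IH]; [simpl; rewrite Nat.add_0_r; ring|].
    rewrite Nat.add_succ_r, S_INR. simpl. fold (farey_orbit x (N + k)).
    unfold farey_map. destruct (Rle_dec 1 _) as [H1|H1].
    - lra.
    - exfalso. apply Hn. exists (N + k)%nat. split; [lia|].
      unfold farey_letter. destruct (Rle_dec 1 _); tauto. }
  destruct (nfloor_ex (farey_orbit x N)) as [k Hk]; [now apply farey_orbit_ge0|].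
  specialize (Hall (S k)). rewrite S_INR in Hall.
  assert (H0 := farey_orbit_ge0 x (N + S k) Hx). lra.
Qed.

(** Subtractive Euclidean algorithm on the pair (p, q): the map sends p / q to (p - q) / q or to p /
    (q - p), and [k] bounds p + q. The test q <= p keeps the new denominator positive in both
    branches. *)
Lemma farey_orbit_quotient (k p q : nat) : (p + q <= k)%nat -> (0 < q)%nat ->
  exists n, farey_orbit (INR p / INR q) n = 0.
Proof.
  revert p q. induction k as [|k IH]; intros p q Hk Hq; [lia|].
  assert (Hq' : 0 < INR q) by now apply lt_0_INR.
  destruct p as [|p].
  { exists 0%nat. simpl. unfold Rdiv. ring. }
  destruct (le_lt_dec q (S p)) as [Hle|Hlt].
  - destruct (IH (S p - q)%nat q) as [n Hn]; try lia.
    exists (1 + n)%nat. rewrite farey_orbit_add. rewrite <- Hn. f_equal.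
    unfold farey_orbit, Nat.iter, nat_rect, farey_map. rewrite minus_INR by trivial. apply le_INR in Hle.
    destruct (Rle_dec 1 _) as [H1|H1]; [field; lra|].
    exfalso. apply H1. apply Rmult_le_reg_r with (INR q); trivial.
    unfold Rdiv. rewrite Rmult_assoc, Rinv_l by lra. lra.
  - destruct (IH (S p) (q - S p)%nat) as [n Hn]; try lia.
    exists (1 + n)%nat. rewrite farey_orbit_add. rewrite <- Hn. f_equal.
    unfold farey_orbit, Nat.iter, nat_rect, farey_map. rewrite minus_INR by lia. apply lt_INR in Hlt.
    destruct (Rle_dec 1 _) as [H1|H1]; [|field; lra].
    exfalso. apply (Rmult_le_compat_r (INR q)) in H1; [|lra].
    unfold Rdiv in H1. rewrite Rmult_assoc, Rinv_l in H1 by lra. lra.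
Qed.

Lemma farey_letter_rational x : 0 <= x -> rational x ->
  exists N, forall n, (N <= n)%nat -> farey_letter x n = false.
Proof.
  intros Hx [[p q] ->]. unfold Q2R in *. cbn [QArith_base.Qnum QArith_base.Qden] in *.
  assert (Hq : 0 < IZR (Zpos q)) by now apply IZR_lt.
  assert (Hp : (0 <= p)%Z).
  { apply le_IZR. apply Rmult_le_reg_r with (/ IZR (Zpos q)); [now apply Rinv_0_lt_compat|lra]. }
  destruct (farey_orbit_quotient (Z.to_nat p + Pos.to_nat q) (Z.to_nat p) (Pos.to_nat q)) as [N HN];
    try lia.
  rewrite !INR_IZR_INZ, Z2Nat.id, positive_nat_Z in HN by trivial. unfold Rdiv in HN.
  exists N. intros n Hn. replace n with (N + (n - N))%nat by lia.
  assert (H0 : forall k, farey_orbit (IZR p * / IZR (Z.pos q)) (N + k) = 0).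
  { intros k. rewrite farey_orbit_add, HN. induction k as [|k IHk]; trivial.
    simpl. fold (farey_orbit 0 k). rewrite IHk. unfold farey_map.
    destruct (Rle_dec 1 0); [lra|]. field. }
  unfold farey_letter. rewrite H0. destruct (Rle_dec 1 0); [lra|trivial].
Qed.

Lemma moebius_R_word l : moebius_R (word_mat l) 1 = word_act l 1.
Proof. now rewrite word_actE by lra. Qed.

Lemma word_mat_snoc l s : word_mat (l ++ [s]) = mat_mul (word_mat l) (letter_mat s).
Proof. rewrite word_mat_app. simpl. now rewrite mat_mul_id_r. Qed.

Lemma farey_word_is_farey_sequence x : 0 < x ->
  is_farey_sequence x (fun n => word_mat (farey_word x n)).
Proof.
  intros Hx. assert (Hx' := Rlt_le _ _ Hx).
  assert (Hs : forall n, word_mat (farey_word x (S n)) =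
     mat_mul (word_mat (farey_word x n)) (letter_mat (farey_letter x n))).
  { intros n. unfold farey_word. now rewrite prefix_S, word_mat_snoc. }
  repeat split; trivial.
  - intros n. rewrite Hs. destruct (farey_letter x n); [now left|now right].
  - apply is_lim_seq_ext with (fun n => word_act (farey_word x n) 1).
    + intros n. now rewrite moebius_R_word.
    + now apply farey_word_lim.
  - intros N. destruct (farey_letter_true_often x Hx' H N) as (n & Hn & Hl).
    exists n. rewrite Hs, Hl. auto.
  - intros N. destruct (farey_letter_false_often x Hx' H N) as (n & Hn & Hl).
    exists n. rewrite Hs, Hl. auto.
  - intros Hr. destruct (farey_letter_rational x Hx' Hr) as [N HN].
    exists N. intros n Hn. rewrite Hs, (HN n Hn). trivial.
Qed.

Lemma farey_sequence_spec x : 0 < x -> is_farey_sequence x (farey_sequence x).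
Proof.
  intros Hx. unfold farey_sequence. apply epsilon_spec.
  eexists. now apply farey_word_is_farey_sequence.
Qed.

(** The sequence is known only through its specification, so its letters are recovered by a
    classical test at each step; the default is [T], and the specification excludes a third case. *)
Lemma farey_sequence_letters x : 0 < x ->
  exists s : nat -> bool, (forall n, farey_sequence x n = word_mat (prefix s n)) /\
    is_lim_seq (fun n => word_act (prefix s n) 1) x /\
    (rational x -> exists N, forall n, (N <= n)%nat -> s n = false).
Proof.
  intros Hx. destruct (farey_sequence_spec x Hx) as (H0 & HS & Hlim & _ & Hrat).
  set (A := farey_sequence x) in *.
  set (s := fun n => if excluded_middle_informative (A (S n) = mat_mul (A n) mat_V)
                     then false else true).
  assert (Hs : forall n, A n = word_mat (prefix s n)).
  { induction n as [|n IH]; [exact H0|].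
    rewrite prefix_S, word_mat_snoc, <- IH. unfold s.
    destruct (excluded_middle_informative _) as [H|H]; trivial.
    destruct (HS n); tauto. }
  exists s. repeat split; trivial.
  - apply is_lim_seq_ext with (2 := Hlim). intros n. now rewrite Hs, moebius_R_word.
  - intros Hr. destruct (Hrat Hr) as [N HN]. exists N. intros n Hn. unfold s.
    destruct (excluded_middle_informative _) as [H|H]; trivial. now elim H; apply HN.
Qed.

(** * Uniqueness of the Farey path of an irrational *)

Lemma letter_act_mono s x y : 0 <= x -> x < y -> letter_act s x < letter_act s y.
Proof.
  intros Hx Hxy. destruct s; simpl; [lra|].
  apply Rmult_lt_reg_r with ((x + 1) * (y + 1)); [nra|].
  replace (x / (x + 1) * ((x + 1) * (y + 1))) with (x * (y + 1)) by (field; lra).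
  replace (y / (y + 1) * ((x + 1) * (y + 1))) with (y * (x + 1)) by (field; lra). nra.
Qed.

Lemma word_act_mono l x y : 0 <= x -> x < y -> word_act l x < word_act l y.
Proof.
  intros Hx Hxy. induction l as [|s l IH]; simpl; trivial.
  apply letter_act_mono; trivial. now apply word_act_ge0.
Qed.

Lemma word_act_le_reg l x y : 0 <= y -> word_act l x <= word_act l y -> x <= y.
Proof.
  intros Hy H. apply Rnot_lt_le. intros Hlt. generalize (word_act_mono l y x Hy Hlt). lra.
Qed.

(** The two letters map [0, oo) into [1, oo) and [0, 1], which meet only at 1. The limit lies in the
    closed image interval of each prefix, and an irrational point never has 1 in its orbit, so every
    letter is forced. *)
Lemma farey_letters_unique x (s : nat -> bool) : 0 < x -> ~ rational x ->
  is_lim_seq (fun n => word_act (prefix s n) 1) x ->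
  forall n, prefix s n = farey_word x n.
Proof.
  intros Hx Hr Hlim. induction n as [|n IH]; trivial.
  unfold farey_word in *. rewrite !prefix_S, IH. do 2 f_equal.
  assert (Hy := farey_orbit_gt0 x n Hr (Rlt_le _ _ Hx)).
  assert (Hyx := word_act_farey_word x n). unfold farey_word in Hyx.
  assert (Hdec : forall k, exists z, 0 <= z /\
     word_act (prefix s (k + S n)) 1 = word_act (prefix (farey_letter x) n) (letter_act (s n) z)).
  { intros k. rewrite Nat.add_comm, prefix_add, prefix_S, IH, !word_act_app.
    eexists. split; [|reflexivity]. apply word_act_ge0. lra. }
  apply (is_lim_seq_incr_n _ (S n)) in Hlim.
  unfold farey_letter. destruct (s n), (Rle_dec 1 (farey_orbit x n)) as [H1|H1]; trivial; exfalso.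
  - apply H1. apply (word_act_le_reg (prefix (farey_letter x) n)); [lra|].
    rewrite Hyx.
    apply (is_lim_seq_le (fun _ => word_act (prefix (farey_letter x) n) 1)
      (fun k => word_act (prefix s (k + S n)) 1) (word_act (prefix (farey_letter x) n) 1) x);
      trivial; [|apply is_lim_seq_const].
    intros k. destruct (Hdec k) as (z & Hz & ->). simpl.
    destruct Hz as [Hz|<-]; [|rewrite Rplus_0_l; lra].
    apply Rlt_le, word_act_mono; lra.
  - assert (H2 : farey_orbit x n <= 1).
    { apply (word_act_le_reg (prefix (farey_letter x) n)); [lra|].
      rewrite Hyx.
      apply (is_lim_seq_le (fun k => word_act (prefix s (k + S n)) 1)
        (fun _ => word_act (prefix (farey_letter x) n) 1) x (word_act (prefix (farey_letter x) n) 1));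
        trivial; [|apply is_lim_seq_const].
      intros k. destruct (Hdec k) as (z & Hz & ->). simpl.
      apply Rlt_le, word_act_mono; [apply Rdiv_le_0_compat; lra|].
      apply Rmult_lt_reg_r with (z + 1); [lra|].
      unfold Rdiv. rewrite Rmult_assoc, Rinv_l by lra. lra. }
    apply (farey_orbit_irrational x n Hr). replace (farey_orbit x n) with 1 by lra.
    apply (rational_IZR 1).
Qed.

(** * Birkhoff sums along words *)

(* Lipschitz in the coordinate [x / (1 + x)] of [0, oo]. *)
Definition circle_lipschitz (K : R) (phi : R -> R) : Prop :=
  forall x y, 0 <= x -> 0 <= y ->
    Rabs (phi x - phi y) * ((1 + x) * (1 + y)) <= K * Rabs (x - y).

(** Vanishing at 0 turns the Lipschitz bound into [phi x <= K * x] and [phi x <= K]; the inversion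
    symmetry is what permits exchanging [T] and [V]. *)
Definition arc_like (K : R) (phi : R -> R) : Prop :=
  circle_lipschitz K phi /\ phi 0 = 0 /\ (forall x, 0 <= x -> 0 <= phi x) /\
  (forall x, 0 < x -> phi (/ x) = phi x).

(** The points visited are A_k^-1 w' when w' is the image of [x] under the whole word: removing a
    prefix leaves the action of the remaining suffix. *)
Fixpoint forward_sum (phi : R -> R) (l : list bool) (x : R) : R :=
  match l with
  | [] => 0
  | s :: l' => phi (word_act l x) + forward_sum phi l' x
  end.

(** Here [y] stands for the negative point -y. Conjugation by x -> -x turns the inverse of a letter
    into the letter itself, so A_k^-1(-y) is minus the image of [y] under the first k letters
    applied in reading order. *)
Fixpoint backward_sum (psi : R -> R) (l : list bool) (y : R) : R :=
  match l with
  | [] => 0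
  | s :: l' => psi y + backward_sum psi l' (letter_act s y)
  end.

(** Makes harmonic sums telescope. With a = sqrt(n + 1) and b = sqrt n, (a - b)(a + b) = 1 and a + b
    <= 2a <= 2 a^2. *)
Lemma inv_le_sqrt_increment (n : nat) :
  / (INR n + 1) <= 2 * (sqrt (INR (S n)) - sqrt (INR n)).
Proof.
  rewrite S_INR. assert (Hn := pos_INR n).
  set (a := sqrt (INR n + 1)). set (b := sqrt (INR n)).
  assert (Ha : a * a = INR n + 1) by (apply sqrt_sqrt; lra).
  assert (Hb : b * b = INR n) by (apply sqrt_sqrt; lra).
  assert (Hb0 : 0 <= b) by apply sqrt_pos.
  assert (Ha1 : 1 <= a) by (unfold a; rewrite <- sqrt_1 at 1; apply sqrt_le_1_alt; lra).
  assert (Hab : b <= a) by (apply sqrt_le_1_alt; lra).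
  rewrite <- Ha. apply Rmult_le_reg_r with (a * a); [nra|].
  rewrite Rinv_l by nra.
  assert (H1 : (a - b) * (a + b) = 1) by (ring_simplify; lra).
  assert ((a - b) * (a + b) <= (a - b) * (2 * (a * a))) by (apply Rmult_le_compat_l; nra).
  lra.
Qed.

Section Sums.

Variables (K : R) (phi psi : R -> R).
Hypothesis K_ge0 : 0 <= K.
Hypothesis phi_arc : arc_like K phi.
Hypothesis psi_arc : arc_like K psi.

(** The weights (1 + u)(1 + v) in the Lipschitz condition and in [word_act_contraction] are the same
    and cancel. *)
Lemma circle_lipschitz_word h l x y : circle_lipschitz K h -> 0 <= x -> 0 <= y ->
  Rabs (h (word_act l x) - h (word_act l y)) <= K * / (INR (length l) + 1).
Proof.
  intros Hh Hx Hy.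
  assert (H1 := Hh _ _ (word_act_ge0 l x Hx) (word_act_ge0 l y Hy)).
  assert (H2 := word_act_contraction l x y Hx Hy).
  assert (Hu := word_act_ge0 l x Hx). assert (Hv := word_act_ge0 l y Hy).
  set (u := word_act l x) in *. set (v := word_act l y) in *.
  assert (Hn := pos_INR (length l)). set (n := INR (length l) + 1) in *.
  assert (Hn1 : 0 < n) by (unfold n; lra).
  assert (HP : 0 < (1 + u) * (1 + v)) by nra.
  apply Rmult_le_reg_r with (((1 + u) * (1 + v)) * n); [nra|].
  replace (K * / n * ((1 + u) * (1 + v) * n)) with (K * ((1 + u) * (1 + v))) by (field; lra).
  assert (H3 : K * (Rabs (u - v) * n) <= K * ((1 + u) * (1 + v))) by now apply Rmult_le_compat_l.
  apply (Rmult_le_compat_r n) in H1; lra.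
Qed.

(** The suffixes have lengths 1, ..., n, so the differences are bounded by a harmonic sum. *)
Lemma forward_sum_close l x y : 0 <= x -> 0 <= y ->
  Rabs (forward_sum phi l x - forward_sum phi l y) <= 2 * K * sqrt (INR (length l)).
Proof.
  intros Hx Hy. induction l as [|s l IH].
  - simpl. rewrite sqrt_0, Rminus_diag, Rabs_R0. lra.
  - cbn [forward_sum].
    assert (H1 := circle_lipschitz_word phi (s :: l) x y (proj1 phi_arc) Hx Hy).
    assert (H2 := inv_le_sqrt_increment (length l)).
    assert (H3 : / (INR (length (s :: l)) + 1) <= / (INR (length l) + 1)).
    { cbn [length]. rewrite S_INR. assert (Hn := pos_INR (length l)).
      apply Rinv_le_contravar; lra. }
    assert (H4 : K * / (INR (length (s :: l)) + 1) <=
       K * (2 * (sqrt (INR (S (length l))) - sqrt (INR (length l))))).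
    { apply Rmult_le_compat_l; lra. }
    apply Rabs_le_between in H1. apply Rabs_le_between in IH.
    apply Rabs_le. cbn [length] in *. lra.
Qed.

(** [m] holds the letters already traversed, the most recent first; its length governs the bound at
    each step, and the square roots telescope. *)
Lemma backward_sum_close_aux l m x y : 0 <= x -> 0 <= y ->
  Rabs (backward_sum psi l (word_act m x) - backward_sum psi l (word_act m y)) <=
    2 * K * (sqrt (INR (length m + length l)) - sqrt (INR (length m))).
Proof.
  intros Hx Hy. revert m. induction l as [|s l IH]; intros m.
  - simpl. rewrite Nat.add_0_r, !Rminus_diag, Rabs_R0. lra.
  - cbn [backward_sum].
    assert (H1 := circle_lipschitz_word psi m x y (proj1 psi_arc) Hx Hy).
    specialize (IH (s :: m)). cbn [word_act fold_right length] in IH.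
    fold (word_act m x) (word_act m y) in IH.
    assert (H2 := inv_le_sqrt_increment (length m)).
    cbn [length]. replace (length m + S (length l))%nat with (S (length m) + length l)%nat by lia.
    assert (H4 : K * / (INR (length m) + 1) <=
       K * (2 * (sqrt (INR (S (length m))) - sqrt (INR (length m))))).
    { apply Rmult_le_compat_l; lra. }
    apply Rabs_le_between in H1. apply Rabs_le_between in IH.
    apply Rabs_le. lra.
Qed.

Lemma backward_sum_close l x y : 0 <= x -> 0 <= y ->
  Rabs (backward_sum psi l x - backward_sum psi l y) <= 2 * K * sqrt (INR (length l)).
Proof.
  intros Hx Hy. assert (H := backward_sum_close_aux l [] x y Hx Hy).
  simpl length in H. change (INR 0) with 0 in H. rewrite sqrt_0, Rminus_0_r in H. exact H.
Qed.

Definition word_sum l := forward_sum phi l 1 + backward_sum psi l 1.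

Lemma word_sum_close l x y : 0 <= x -> 0 <= y ->
  Rabs (forward_sum phi l x + backward_sum psi l y - word_sum l) <= 4 * K * sqrt (INR (length l)).
Proof.
  intros Hx Hy. assert (H1 := forward_sum_close l x 1 Hx Rle_0_1).
  assert (H2 := backward_sum_close l y 1 Hy Rle_0_1). unfold word_sum.
  apply Rabs_le_between in H1. apply Rabs_le_between in H2. apply Rabs_le. lra.
Qed.

Lemma arc_like_le h x : arc_like K h -> 0 <= x -> h x <= K * x /\ h x <= K.
Proof.
  intros (H & H0 & Hp & _) Hx. specialize (H x 0 Hx (Rle_refl 0)). specialize (Hp x Hx).
  rewrite H0, !Rminus_0_r, !Rabs_pos_eq in H by trivial.
  split; nra.
Qed.

Lemma forward_sum_bounds l x : 0 <= x -> 0 <= forward_sum phi l x <= K * INR (length l).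
Proof.
  intros Hx. induction l as [|s l IH]; [simpl; lra|].
  cbn [forward_sum length]. rewrite S_INR.
  assert (Hu := word_act_ge0 (s :: l) x Hx).
  destruct (arc_like_le phi _ phi_arc Hu) as [_ H1].
  destruct phi_arc as (_ & _ & Hp & _). specialize (Hp _ Hu). lra.
Qed.

Lemma backward_sum_bounds l y : 0 <= y -> 0 <= backward_sum psi l y <= K * INR (length l).
Proof.
  revert y. induction l as [|s l IH]; intros y Hy; [simpl; lra|].
  cbn [backward_sum length]. rewrite S_INR.
  specialize (IH _ (letter_act_ge0 s y Hy)).
  destruct (arc_like_le psi _ psi_arc Hy) as [_ H1].
  destruct psi_arc as (_ & _ & Hp & _). specialize (Hp _ Hy). lra.
Qed.

Lemma word_sum_bounds l : 0 <= word_sum l <= 2 * K * INR (length l).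
Proof.
  assert (H1 := forward_sum_bounds l 1 Rle_0_1). assert (H2 := backward_sum_bounds l 1 Rle_0_1).
  unfold word_sum. lra.
Qed.

(** The forward points depend only on suffixes, so the new letter adds one term there. In the
    backward sum it adds one term and moves the starting point from 1 to its image, which
    [backward_sum_close] controls. *)
Lemma word_sum_cons s l :
  Rabs (word_sum (s :: l) - word_sum l) <= 2 * K + 2 * K * sqrt (INR (length l)).
Proof.
  unfold word_sum. cbn [forward_sum backward_sum].
  assert (Hu := word_act_ge0 (s :: l) 1 Rle_0_1).
  destruct (arc_like_le phi _ phi_arc Hu) as [_ H1].
  destruct (arc_like_le psi 1 psi_arc Rle_0_1) as [_ H2].
  assert (Hp := proj1 (proj2 (proj2 phi_arc)) _ Hu).
  assert (Hq := proj1 (proj2 (proj2 psi_arc)) _ Rle_0_1).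
  assert (H3 := backward_sum_close l _ _ (letter_act_ge0 s 1 Rle_0_1) Rle_0_1).
  apply Rabs_le_between in H3. apply Rabs_le. lra.
Qed.

Lemma word_sum_app l l' :
  Rabs (word_sum (l ++ l') - word_sum l') <=
    INR (length l) * (2 * K + 2 * K * sqrt (INR (length (l ++ l')))).
Proof.
  induction l as [|s l IH].
  - simpl. rewrite Rminus_diag, Rabs_R0. lra.
  - assert (H := word_sum_cons s (l ++ l')). cbn [app length]. rewrite S_INR.
    assert (Hs : sqrt (INR (length (l ++ l'))) <= sqrt (INR (S (length (l ++ l'))))).
    { apply sqrt_le_1_alt, le_INR. lia. }
    assert (H1 : K * sqrt (INR (length (l ++ l'))) <= K * sqrt (INR (S (length (l ++ l'))))).
    { now apply Rmult_le_compat_l. }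
    assert (H2 := pos_INR (length l)).
    assert (H3 : INR (length l) * (K * sqrt (INR (length (l ++ l')))) <=
                 INR (length l) * (K * sqrt (INR (S (length (l ++ l')))))).
    { now apply Rmult_le_compat_l. }
    apply Rabs_le_between in H. apply Rabs_le_between in IH. apply Rabs_le. lra.
Qed.

Lemma letter_act_negb s x : 0 < x -> letter_act (negb s) (/ x) = / letter_act s x.
Proof. intros Hx. destruct s; simpl; field; lra. Qed.

Lemma word_act_negb l x : 0 < x -> word_act (map negb l) (/ x) = / word_act l x.
Proof.
  intros Hx. induction l as [|s l IH]; trivial. simpl. rewrite IH.
  apply letter_act_negb. now apply word_act_gt0.
Qed.

(** The base point 1 is fixed by x -> 1 / x, which conjugates [T] to [V]; the sums therefore agree
    term by term. *)
Lemma word_sum_negb l : word_sum (map negb l) = word_sum l.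
Proof.
  unfold word_sum. f_equal.
  - induction l as [|s l IH]; trivial.
    change (map negb (s :: l)) with (negb s :: map negb l). cbn [forward_sum].
    rewrite IH. f_equal. change (negb s :: map negb l) with (map negb (s :: l)).
    rewrite <- Rinv_1 at 1. rewrite word_act_negb by lra.
    apply phi_arc. apply word_act_gt0. lra.
  - assert (H : forall y, 0 < y -> backward_sum psi (map negb l) (/ y) = backward_sum psi l y).
    { induction l as [|s l IH]; intros y Hy; trivial. simpl.
      rewrite (proj2 (proj2 (proj2 psi_arc))), letter_act_negb, IH; trivial.
      now apply letter_act_gt0. }
    rewrite <- Rinv_1 at 1. apply H. lra.
Qed.

Lemma word_act_repeat_V k : word_act (repeat false k) 1 = / (INR k + 1).
Proof.
  induction k as [|k IH]; [simpl; field|]. rewrite S_INR. simpl.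
  rewrite IH. assert (H := pos_INR k). field. lra.
Qed.

(** The points visited decrease like 1 / k towards 0, where phi vanishes at least linearly, which
    leaves a harmonic sum. *)
Lemma forward_sum_repeat_V k : forward_sum phi (repeat false k) 1 <= 2 * K * sqrt (INR k).
Proof.
  induction k as [|k IH]; [simpl; rewrite sqrt_0; lra|].
  change (repeat false (S k)) with (false :: repeat false k). cbn [forward_sum].
  change (false :: repeat false k) with (repeat false (S k)). rewrite word_act_repeat_V.
  assert (H := pos_INR k).
  assert (Hi : 0 < / (INR (S k) + 1)) by (apply Rinv_0_lt_compat; rewrite S_INR; lra).
  destruct (arc_like_le phi _ phi_arc (Rlt_le _ _ Hi)) as [H1 _].
  assert (H2 := inv_le_sqrt_increment k).
  assert (H3 : / (INR (S k) + 1) <= / (INR k + 1)).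
  { rewrite S_INR. apply Rinv_le_contravar; lra. }
  assert (H4 : K * / (INR (S k) + 1) <= K * (2 * (sqrt (INR (S k)) - sqrt (INR k)))).
  { apply Rmult_le_compat_l; lra. }
  lra.
Qed.

(** The starting point is kept general because [V] sends 1 / (m + 1) to 1 / (m + 2). *)
Lemma backward_sum_repeat_V k m :
  backward_sum psi (repeat false k) (/ (INR m + 1)) <= 2 * K * (sqrt (INR (m + k)) - sqrt (INR m)).
Proof.
  revert m. induction k as [|k IH]; intros m.
  - simpl. rewrite Nat.add_0_r. lra.
  - change (repeat false (S k)) with (false :: repeat false k). cbn [backward_sum].
    assert (H := pos_INR m).
    assert (Hi : 0 < / (INR m + 1)) by (apply Rinv_0_lt_compat; lra).
    destruct (arc_like_le psi _ psi_arc (Rlt_le _ _ Hi)) as [H1 _].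
    assert (H2 := inv_le_sqrt_increment m).
    replace (letter_act false (/ (INR m + 1))) with (/ (INR (S m) + 1)).
    2:{ rewrite S_INR. simpl. field. lra. }
    specialize (IH (S m)). replace (m + S k)%nat with (S m + k)%nat by lia.
    assert (H4 : K * / (INR m + 1) <= K * (2 * (sqrt (INR (S m)) - sqrt (INR m)))).
    { apply Rmult_le_compat_l; lra. }
    lra.
Qed.

Lemma word_sum_repeat_V k : word_sum (repeat false k) <= 4 * K * sqrt (INR k).
Proof.
  assert (H1 := forward_sum_repeat_V k). assert (H2 := backward_sum_repeat_V k 0).
  simpl in H2. rewrite Rplus_0_l, Rinv_1, sqrt_0 in H2. unfold word_sum. lra.
Qed.

(** Dropping the first N letters costs N(2K + 2K sqrt n) by [word_sum_app]; the remaining block of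
    [V]'s contributes at most 4K sqrt n. *)
Lemma word_sum_eventually_V s N n : (forall i, (N <= i)%nat -> s i = false) -> (N <= n)%nat ->
  word_sum (prefix s n) <= 2 * K * INR N + (4 * K + 2 * K * INR N) * sqrt (INR n).
Proof.
  intros Hs Hn. replace n with (N + (n - N))%nat by lia. set (k := (n - N)%nat).
  assert (Hk : prefix (fun i => s (N + i)%nat) k = repeat false k).
  { induction k as [|k' IH]; trivial. rewrite prefix_S, IH, Hs by lia.
    symmetry. apply repeat_cons. }
  assert (H1 := word_sum_app (prefix s N) (prefix (fun i => s (N + i)%nat) k)).
  rewrite <- prefix_add, !length_prefix, Hk in H1.
  assert (H2 := word_sum_repeat_V k).
  assert (Hsq : sqrt (INR k) <= sqrt (INR (N + k))) by (apply sqrt_le_1_alt, le_INR; lia).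
  assert (K * sqrt (INR k) <= K * sqrt (INR (N + k))) by now apply Rmult_le_compat_l.
  apply Rabs_le_between in H1. lra.
Qed.

End Sums.

(** * Limits superior *)

(** The shift by [k] permits comparing averages over words of different lengths, as when a letter is
    prepended. *)
Lemma is_LimSup_seq_close (u v : nat -> R) (k : nat) (l : R) :
  is_lim_seq (fun n => u (n + k)%nat - v n) 0 ->
  is_LimSup_seq v l -> is_LimSup_seq u l.
Proof.
  intros H Hv eps.
  assert (He2 : 0 < eps / 2) by (generalize (cond_pos eps); lra).
  apply is_lim_seq_spec in H. destruct (H (mkposreal _ He2)) as [N0 HN0]. cbn in HN0.
  destruct (Hv (mkposreal _ He2)) as [H1 [N2 H2]]. cbn in H1, H2. split.
  - intros N. destruct (H1 (N + N0)%nat) as (n & Hn & Hl).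
    exists (n + k)%nat. split; [lia|].
    specialize (HN0 n ltac:(lia)). apply Rabs_def2 in HN0. lra.
  - exists (N0 + N2 + k)%nat. intros n Hn.
    specialize (HN0 (n - k)%nat ltac:(lia)). specialize (H2 (n - k)%nat ltac:(lia)).
    replace (n - k + k)%nat with n in HN0 by lia. apply Rabs_def2 in HN0. lra.
Qed.

Lemma is_lim_seq_sqrt_div (a b : R) : is_lim_seq (fun n => (a + b * sqrt (INR n)) / INR n) 0.
Proof.
  assert (H : is_lim_seq (fun n => a * / INR n + b * / sqrt (INR n)) 0).
  { replace (Finite 0) with (Finite (a * 0 + b * 0)) by (f_equal; ring).
    apply is_lim_seq_plus'.
    - apply (is_lim_seq_scal_l _ a 0).
      apply (is_lim_seq_inv _ p_infty); [apply is_lim_seq_INR|easy].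
    - apply (is_lim_seq_scal_l _ b 0).
      apply (is_lim_seq_inv _ p_infty); [|easy].
      apply (filterlim_comp _ _ _ INR sqrt _ (Rbar_locally p_infty)).
      + apply is_lim_seq_INR.
      + apply filterlim_sqrt_p. }
  apply is_lim_seq_ext_loc with (2 := H).
  exists 1%nat. intros n Hn. assert (Hp : 0 < INR n) by (apply lt_0_INR; lia).
  assert (Hs := sqrt_lt_R0 _ Hp). assert (Hss := sqrt_sqrt (INR n) ltac:(lra)).
  set (r := sqrt (INR n)) in *. rewrite <- Hss. field. lra.
Qed.

Lemma is_lim_seq_0_le_sqrt (u : nat -> R) (a b : R) (N : nat) :
  (forall n, (N <= n)%nat -> Rabs (u n) <= (a + b * sqrt (INR n)) / INR n) -> is_lim_seq u 0.
Proof.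
  intros H. apply is_lim_seq_abs_0.
  apply (is_lim_seq_le_le_loc (fun _ => 0) _ (fun n => (a + b * sqrt (INR n)) / INR n)).
  - exists N. intros n Hn. split; [apply Rabs_pos|]. now apply H.
  - apply is_lim_seq_const.
  - apply is_lim_seq_sqrt_div.
Qed.

Lemma is_LimSup_seq_bounded (u : nat -> R) (a b : R) :
  (forall n, (0 < n)%nat -> a <= u n <= b) -> is_LimSup_seq u (Finite (real (LimSup_seq u))).
Proof.
  intros H. destruct (ex_LimSup_seq u) as [l Hl]. rewrite (is_LimSup_seq_unique u l Hl).
  destruct l as [l| |]; trivial; exfalso.
  - destruct (Hl b 1%nat) as (n & Hn & Hlt). specialize (H n ltac:(lia)). lra.
  - destruct (Hl a) as [N HN]. specialize (HN (S N) ltac:(lia)). specialize (H (S N) ltac:(lia)). lra.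
Qed.

(** * The exponent and its invariance *)

Lemma prefix_ext s t n : (forall i, s i = t i) -> prefix s n = prefix t n.
Proof. intros H. apply map_ext. exact H. Qed.

Lemma farey_word_plus1 x n : 0 <= x -> farey_word (x + 1) (S n) = true :: farey_word x n.
Proof.
  intros Hx.
  assert (H1 : farey_orbit (x + 1) 1 = x).
  { unfold farey_orbit, Nat.iter, nat_rect, farey_map. destruct (Rle_dec 1 (x + 1)); lra. }
  unfold farey_word. change (S n) with (1 + n)%nat. rewrite prefix_add.
  unfold prefix at 1. simpl. f_equal.
  - unfold farey_letter. simpl. destruct (Rle_dec 1 (x + 1)); [trivial|lra].
  - apply prefix_ext. intros i. unfold farey_letter. change (S i) with (1 + i)%nat.
    now rewrite farey_orbit_add, H1.
Qed.

(** Inversion exchanges the branches y - 1 and y / (1 - y). At y = 1 both y and 1 / y would take the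
    [T] branch, which is why x is irrational. *)
Lemma farey_orbit_inv x n : 0 < x -> ~ rational x -> farey_orbit (/ x) n = / farey_orbit x n.
Proof.
  intros Hx Hr. induction n as [|n IH]; trivial.
  assert (Hp := farey_orbit_gt0 x n Hr (Rlt_le _ _ Hx)).
  simpl. fold (farey_orbit (/ x) n) (farey_orbit x n). rewrite IH.
  assert (Hne : farey_orbit x n <> 1).
  { intros H. apply (farey_orbit_irrational x n Hr). rewrite H. apply (rational_IZR 1). }
  set (y := farey_orbit x n) in *. unfold farey_map.
  assert (Hy : y * / y = 1) by (field; lra).
  assert (Hyp := Rinv_0_lt_compat y Hp).
  destruct (Rle_dec 1 y) as [H1|H1], (Rle_dec 1 (/ y)) as [H2|H2].
  - exfalso. nra.
  - field. split; [lra|]. intros H0. apply Hne. lra.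
  - field. lra.
  - exfalso. nra.
Qed.

Lemma farey_word_inv x n : 0 < x -> ~ rational x -> farey_word (/ x) n = map negb (farey_word x n).
Proof.
  intros Hx Hr. unfold farey_word, prefix. rewrite map_map. apply map_ext. intros i.
  unfold farey_letter. rewrite farey_orbit_inv by trivial.
  assert (Hp := farey_orbit_gt0 x i Hr (Rlt_le _ _ Hx)).
  assert (Hne : farey_orbit x i <> 1).
  { intros H. apply (farey_orbit_irrational x i Hr). rewrite H. apply (rational_IZR 1). }
  set (y := farey_orbit x i) in *.
  assert (Hy : y * / y = 1) by (field; lra).
  assert (Hyp := Rinv_0_lt_compat y Hp).
  destruct (Rle_dec 1 y) as [H1|H1], (Rle_dec 1 (/ y)) as [H2|H2]; trivial; exfalso; nra.
Qed.

(** * Rationality under Moebius transformations *)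

Lemma rational_moebius_R A x : rational x -> rational (moebius_R A x).
Proof.
  intros H. unfold moebius_R. apply rational_div; apply rational_plus; try apply rational_IZR;
  apply rational_mult; trivial; apply rational_IZR.
Qed.

Lemma irrational_linear_neq0 (c d : Z) x : ~ rational x -> (c <> 0 \/ d <> 0)%Z ->
  IZR c * x + IZR d <> 0.
Proof.
  intros Hr Hcd H. destruct (Z.eq_dec c 0) as [->|Hc].
  - rewrite Rmult_0_l, Rplus_0_l in H. apply eq_IZR in H. lia.
  - assert (Hc' := not_0_IZR c Hc). apply Hr. replace x with (- IZR d / IZR c).
    + apply rational_div; [apply rational_opp|]; apply rational_IZR.
    + apply (Rmult_eq_reg_r (IZR c)); trivial. unfold Rdiv.
      rewrite Rmult_assoc, Rinv_l by trivial. lra.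
Qed.

Lemma GL2Z_row2_neq0 A : GL2Z A -> (m21 A <> 0 \/ m22 A <> 0)%Z.
Proof. intros H. destruct A as [a b c d]. unfold GL2Z, mat_det in H. simpl in *. lia. Qed.

Lemma irrational_moebius_R A x : GL2Z A -> ~ rational x -> ~ rational (moebius_R A x).
Proof.
  intros HA Hr H. apply Hr.
  assert (Hden := irrational_linear_neq0 _ _ x Hr (GL2Z_row2_neq0 A HA)).
  set (y := moebius_R A x) in *.
  assert (Hy : (IZR (m21 A) * y - IZR (m11 A)) * x = IZR (m12 A) - IZR (m22 A) * y).
  { unfold y, moebius_R. field. trivial. }
  assert (Hdet : IZR (m11 A) * IZR (m22 A) - IZR (m12 A) * IZR (m21 A) <> 0).
  { rewrite <- !mult_IZR, <- minus_IZR. apply not_0_IZR. unfold GL2Z, mat_det in HA. lia. }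
  (* Indeed (c y - a)(c x + d) = -(a d - b c). *)
  assert (Hne : IZR (m21 A) * y - IZR (m11 A) <> 0).
  { intros H0. apply Hdet.
    replace (IZR (m11 A) * IZR (m22 A) - IZR (m12 A) * IZR (m21 A)) with
      (- (IZR (m21 A) * y - IZR (m11 A)) * (IZR (m21 A) * x + IZR (m22 A))).
    - rewrite H0. ring.
    - unfold y, moebius_R. field. trivial. }
  replace x with ((IZR (m12 A) - IZR (m22 A) * y) / (IZR (m21 A) * y - IZR (m11 A))).
  - apply rational_div; apply rational_minus; try apply rational_IZR;
      apply rational_mult; trivial; apply rational_IZR.
  - rewrite <- Hy. field. trivial.
Qed.

Section Exponent.

Variables (K : R) (phi psi : R -> R).
Hypothesis K_ge0 : 0 <= K.
Hypothesis phi_arc : arc_like K phi.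
Hypothesis psi_arc : arc_like K psi.

(** The averages lie in [0, 2K], so taking [real] loses nothing. *)
Definition farey_exponent (x : R) : R :=
  real (LimSup_seq (fun n => word_sum phi psi (farey_word x n) / INR n)).

Lemma word_sum_average_bounds (l : list bool) n : (0 < n)%nat -> length l = n ->
  0 <= word_sum phi psi l / INR n <= 2 * K.
Proof.
  intros Hn Hl. apply lt_0_INR in Hn.
  assert (H := word_sum_bounds K phi psi K_ge0 phi_arc psi_arc l). rewrite Hl in H.
  split.
  - apply Rdiv_le_0_compat; lra.
  - apply Rmult_le_reg_r with (INR n); trivial.
    unfold Rdiv. rewrite Rmult_assoc, Rinv_l by lra. lra.
Qed.

Lemma farey_exponent_spec x :
  is_LimSup_seq (fun n => word_sum phi psi (farey_word x n) / INR n) (Finite (farey_exponent x)).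
Proof.
  apply (is_LimSup_seq_bounded _ 0 (2 * K)). intros n Hn.
  apply word_sum_average_bounds; trivial. apply length_prefix.
Qed.

Lemma farey_exponent_plus1 x : 0 <= x -> farey_exponent (x + 1) = farey_exponent x.
Proof.
  intros Hx. unfold farey_exponent at 1.
  rewrite (is_LimSup_seq_unique _ (Finite (farey_exponent x))); trivial.
  apply is_LimSup_seq_close with (k := 1%nat) (2 := farey_exponent_spec x).
  (* Of 4K, one half comes from prepending the letter, the other from the passage from n to n + 1 in
     the denominator, which costs one average W / n. *)
  apply is_lim_seq_0_le_sqrt with (a := 4 * K) (b := 2 * K) (N := 1%nat).
  intros n Hn. rewrite Nat.add_1_r, farey_word_plus1 by trivial.
  assert (H1 := word_sum_cons K phi psi K_ge0 phi_arc psi_arc true (farey_word x n)).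
  unfold farey_word in H1 at 3. rewrite length_prefix in H1.
  assert (Hp : 0 < INR n) by (apply lt_0_INR; lia). rewrite S_INR.
  set (W := word_sum phi psi (farey_word x n)) in *.
  set (W' := word_sum phi psi (true :: farey_word x n)) in *.
  replace (W' / (INR n + 1) - W / INR n) with
    (((W' - W) - W / INR n) / (INR n + 1)) by (field; lra).
  assert (Hs := sqrt_pos (INR n)).
  assert (HW : 0 <= W / INR n <= 2 * K).
  { apply word_sum_average_bounds; [lia|apply length_prefix]. }
  unfold Rdiv at 1. rewrite Rabs_mult, Rabs_inv, (Rabs_pos_eq (INR n + 1)) by lra.
  assert (Hb : Rabs (W' - W - W / INR n) <= 4 * K + 2 * K * sqrt (INR n)).
  { apply Rabs_le_between in H1. apply Rabs_le. lra. }
  assert (Hi : 0 < / (INR n + 1)) by (apply Rinv_0_lt_compat; lra).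
  assert (Hi' : / (INR n + 1) <= / INR n) by (apply Rinv_le_contravar; lra).
  apply Rmult_le_compat; try lra. apply Rabs_pos.
Qed.

Lemma farey_exponent_inv x : 0 < x -> ~ rational x -> farey_exponent (/ x) = farey_exponent x.
Proof.
  intros Hx Hr. unfold farey_exponent. do 2 f_equal.
  apply functional_extensionality. intros n.
  rewrite farey_word_inv by trivial. now rewrite (word_sum_negb K).
Qed.

Lemma irrational_Rabs x : ~ rational x -> 0 < Rabs x /\ ~ rational (Rabs x).
Proof.
  intros Hr. split.
  - apply Rabs_pos_lt. intros ->. apply Hr, (rational_IZR 0).
  - unfold Rabs. destruct (Rcase_abs x); trivial.
    intros H. apply Hr. rewrite <- (Ropp_involutive x). now apply rational_opp.
Qed.

(** Needed for the translation of x in (-1, 0), where |x| = y and |x + 1| = 1 - y. *)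
Lemma farey_exponent_one_minus y : 0 < y < 1 -> ~ rational y ->
  farey_exponent (1 - y) = farey_exponent y.
Proof.
  intros Hy Hr.
  assert (Hr' : ~ rational (1 - y)).
  { intros H. apply Hr. replace y with (1 - (1 - y)) by ring.
    apply rational_minus; trivial. apply (rational_IZR 1). }
  assert (Hinv : forall z, ~ rational z -> ~ rational (/ z)).
  { intros z Hz H. apply Hz. rewrite <- (Rinv_inv z). now apply rational_inv. }
  rewrite <- (farey_exponent_inv (1 - y)), <- (farey_exponent_inv y) by (trivial; lra).
  (* Both [1 / y] and [1 / (1 - y)] are translates by 1, of [u] and [1 / u]. *)
  set (u := (1 - y) / y).
  assert (Hu : 0 < u) by (apply Rdiv_lt_0_compat; lra).
  assert (Hur : ~ rational u).
  { intros H. apply (Hinv y Hr). replace (/ y) with (u + 1) by (unfold u; field; lra).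
    apply rational_plus; trivial. apply (rational_IZR 1). }
  replace (/ (1 - y)) with (/ u + 1) by (unfold u; field; lra).
  replace (/ y) with (u + 1) by (unfold u; field; lra).
  assert (Hiu := Rinv_0_lt_compat u Hu).
  rewrite !farey_exponent_plus1 by lra. now apply farey_exponent_inv.
Qed.

Lemma farey_exponent_Rabs_plus1 x : ~ rational x ->
  farey_exponent (Rabs (x + 1)) = farey_exponent (Rabs x).
Proof.
  intros Hr. destruct (Rlt_le_dec 0 x) as [H|H].
  - rewrite !Rabs_pos_eq by lra. apply farey_exponent_plus1. lra.
  - rewrite (Rabs_left1 x) by trivial. destruct (Rle_lt_dec x (- 1)) as [H1|H1].
    + rewrite Rabs_left1 by lra. rewrite <- farey_exponent_plus1 by lra. f_equal. lra.
    + destruct H as [H|H]; [|exfalso; apply Hr; rewrite H; apply (rational_IZR 0)].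
      rewrite Rabs_pos_eq by lra. rewrite <- (farey_exponent_one_minus (- x)); [f_equal; ring|lra|].
      intros Hn. apply Hr. rewrite <- (Ropp_involutive x). now apply rational_opp.
Qed.

Lemma farey_exponent_Rabs_plus_INR x k : ~ rational x ->
  farey_exponent (Rabs (x + INR k)) = farey_exponent (Rabs x).
Proof.
  intros Hr. induction k as [|k IH]; [simpl; now rewrite Rplus_0_r|].
  rewrite S_INR, <- Rplus_assoc, farey_exponent_Rabs_plus1; trivial.
  intros H. apply Hr. replace x with (x + INR k - INR k) by ring.
  apply rational_minus; trivial. rewrite INR_IZR_INZ. apply rational_IZR.
Qed.

Lemma farey_exponent_Rabs_plus_IZR x z : ~ rational x ->
  farey_exponent (Rabs (x + IZR z)) = farey_exponent (Rabs x).
Proof.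
  intros Hr. destruct (Z_le_gt_dec 0 z) as [Hz|Hz].
  - rewrite <- (Z2Nat.id z) by trivial. rewrite <- INR_IZR_INZ. now apply farey_exponent_Rabs_plus_INR.
  - rewrite <- (farey_exponent_Rabs_plus_INR (x + IZR z) (Z.to_nat (- z))).
    + f_equal. f_equal. rewrite INR_IZR_INZ, Z2Nat.id, opp_IZR by lia. ring.
    + intros H. apply Hr. replace x with (x + IZR z - IZR z) by ring.
      apply rational_minus; trivial. apply rational_IZR.
Qed.

Lemma farey_exponent_Rabs_inv x : ~ rational x ->
  farey_exponent (Rabs (/ x)) = farey_exponent (Rabs x).
Proof.
  intros Hr. destruct (irrational_Rabs x Hr) as [H1 H2].
  rewrite Rabs_inv. now apply farey_exponent_inv.
Qed.

(* Euclid's algorithm on the left column writes [A] in terms of translations and [x -> 1 / x]. *)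
Lemma farey_exponent_Rabs_moebius A x : GL2Z A -> ~ rational x ->
  farey_exponent (Rabs (moebius_R A x)) = farey_exponent (Rabs x).
Proof.
  intros HA Hr.
  assert (HN : exists N, (Z.to_nat (Z.abs (m21 A)) <= N)%nat) by (eexists; apply Nat.le_refl).
  destruct HN as [N HN]. revert A HA HN.
  induction N as [|N IH]; intros [a b c d] HA HN; simpl in HN.
  - assert (c = 0)%Z by lia. subst c.
    assert (Had : ((a = 1 \/ a = -1) /\ (d = 1 \/ d = -1))%Z).
    { unfold GL2Z, mat_det in HA. simpl in HA.
      assert (E : (a * d = 1 \/ a * d = -1)%Z) by lia.
      destruct (Z.eq_dec d 0) as [->|Hd0]; [lia|].
      destruct (Z.eq_dec a 0) as [->|Ha0]; [lia|].
      assert (Z.abs a * Z.abs d = 1)%Z by (rewrite <- Z.abs_mul; lia).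
      assert (Z.abs a = 1)%Z by nia. assert (Z.abs d = 1)%Z by nia. lia. }
    (* A triangular matrix acts as x -> x + z or x -> -(x + z). *)
    assert (Hcase : exists z, moebius_R (Mat2 a b 0 d) x = x + IZR z \/
                              moebius_R (Mat2 a b 0 d) x = - (x + IZR z)).
    { unfold moebius_R. simpl. destruct Had as [[-> | ->] [-> | ->]].
      - exists b. left. field.
      - exists b. right. field.
      - exists (- b)%Z. right. rewrite opp_IZR. field.
      - exists (- b)%Z. left. rewrite opp_IZR. field. }
    destruct Hcase as [z [-> | ->]]; rewrite ?Rabs_Ropp; now apply farey_exponent_Rabs_plus_IZR.
  - destruct (Z.eq_dec c 0) as [->|Hc].
    { apply IH; trivial. simpl. lia. }
    (* One Euclidean step: A x = q + 1 / (A' x). Swapping the rows changes the sign of the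
       determinant, so the induction has to run over [GL2Z]. *)
    set (q := (a / c)%Z).
    set (A' := Mat2 c d (a - q * c) (b - q * d)).
    assert (HA' : GL2Z A').
    { unfold GL2Z, mat_det, A' in *. simpl in *.
      assert (c * (b - q * d) - d * (a - q * c) = - (a * d - b * c))%Z by ring. lia. }
    assert (Hrem : (Z.abs (a - q * c) < Z.abs c)%Z).
    { replace (a - q * c)%Z with (a mod c)%Z by (unfold q; rewrite Z.mod_eq by trivial; ring).
      generalize (Z.mod_bound_or a c Hc). lia. }
    assert (Hir := irrational_moebius_R A' x HA' Hr).
    rewrite <- (IH A' HA') by (simpl; lia).
    assert (Hden := irrational_linear_neq0 _ _ x Hr (GL2Z_row2_neq0 _ HA)).
    assert (Hden' := irrational_linear_neq0 _ _ x Hr (GL2Z_row2_neq0 _ HA')).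
    simpl in Hden, Hden'.
    replace (moebius_R (Mat2 a b c d) x) with (/ moebius_R A' x + IZR q).
    + rewrite farey_exponent_Rabs_plus_IZR; [now apply farey_exponent_Rabs_inv|].
      intros H. apply Hir. rewrite <- (Rinv_inv (moebius_R A' x)). now apply rational_inv.
    + unfold moebius_R, A'. simpl. rewrite !minus_IZR, !mult_IZR in *. field. auto.
Qed.

(** The value at |x| accounts for x -> -x. Rational points and infinity form one orbit and receive 0
    directly; that this agrees with the limit superior is checked in [limsup_farey_average]. *)
Definition exponent (p : P1R) : R :=
  match p with
  | P1_fin x => if excluded_middle_informative (rational x) then 0 else farey_exponent (Rabs x)
  | P1_inf => 0
  end.

Lemma exponent_rational p : P1_rational p -> exponent p = 0.
Proof.
  destruct p as [x|]; trivial. simpl. intros H.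
  now destruct (excluded_middle_informative (rational x)).
Qed.

Lemma exponent_moebius A p : GL2Z A -> exponent (moebius_P1 A p) = exponent p.
Proof.
  intros HA. destruct (excluded_middle_informative (P1_rational p)) as [H|H].
  - rewrite (exponent_rational p H). apply exponent_rational.
    destruct p as [x|]; simpl.
    + destruct (Req_EM_T _ 0); simpl; trivial. now apply rational_moebius_R.
    + destruct (Req_EM_T _ 0); simpl; trivial. apply rational_div; apply rational_IZR.
  - destruct p as [x|]; [|now elim H]. simpl in H.
    assert (Hden := irrational_linear_neq0 _ _ x H (GL2Z_row2_neq0 A HA)).
    assert (Hir := irrational_moebius_R A x HA H).
    simpl. destruct (Req_EM_T _ 0); [tauto|]. simpl.
    destruct (excluded_middle_informative (rational x)); [tauto|].
    destruct (excluded_middle_informative (rational (moebius_R A x))); [tauto|].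
    now apply farey_exponent_Rabs_moebius.
Qed.

(* [u n] plays the role of [Re (I_f (A_n))]. *)
Lemma limsup_farey_average (x : R) (u : nat -> R) : 0 < x ->
  (forall n l, farey_sequence x n = word_mat l -> In true l -> In false l ->
    Rabs (u n - word_sum phi psi l) <= 4 * K * sqrt (INR (length l))) ->
  LimSup_seq (fun n => u n / INR n) = Finite (exponent (P1_fin x)).
Proof.
  intros Hx Hu. apply is_LimSup_seq_unique.
  destruct (farey_sequence_letters x Hx) as (s & Hs & Hlim & Hrat).
  (* Without a [T] the images of 1 would be 1 / (n + 1), with limit 0 instead of x > 0. *)
  assert (HT : exists i, s i = true).
  { apply NNPP. intros Hno.
    assert (Hall : forall i, s i = false).
    { intros i. destruct (s i) eqn:E; trivial. elim Hno. now exists i. }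
    assert (Hrep : forall n, prefix s n = repeat false n).
    { induction n as [|n IH]; trivial. rewrite prefix_S, IH, Hall. symmetry. apply repeat_cons. }
    apply (Rlt_irrefl 0). apply Rlt_le_trans with x; trivial.
    apply (is_lim_seq_le_loc (fun n => word_act (prefix s n) 1)
      (fun n => (1 + 0 * sqrt (INR n)) / INR n) x 0); trivial; [|apply is_lim_seq_sqrt_div].
    exists 1%nat. intros n Hn. rewrite Hrep, word_act_repeat_V, Rmult_0_l, Rplus_0_r.
    assert (Hp : 0 < INR n) by (apply lt_0_INR; lia).
    unfold Rdiv. rewrite Rmult_1_l. apply Rinv_le_contravar; lra. }
  (* For irrational x the letters agree with those of [farey_letter], among which [V] occurs
     infinitely often. *)
  assert (HV : exists i, s i = false).
  { destruct (excluded_middle_informative (rational x)) as [Hr|Hr].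
    - destruct (Hrat Hr) as [N HN]. exists N. now apply HN.
    - destruct (farey_letter_false_often x (Rlt_le _ _ Hx) Hr 0) as (i & _ & Hi). exists i.
      assert (E := farey_letters_unique x s Hx Hr Hlim (S i)).
      unfold farey_word in E. rewrite !prefix_S in E. apply app_inj_tail in E.
      now rewrite (proj2 E). }
  destruct HT as [i Hi]. destruct HV as [j Hj].
  (* Every prefix longer than i + j contains both letters; the finitely many others do not affect
     the limit superior. *)
  assert (Hclose : forall n, (S (i + j) <= n)%nat ->
     Rabs (u n - word_sum phi psi (prefix s n)) <= 4 * K * sqrt (INR n)).
  { intros n Hn. rewrite <- (length_prefix s n) at 3. apply Hu; trivial.
    - rewrite <- Hi. apply In_prefix. lia.
    - rewrite <- Hj. apply In_prefix. lia. }
  simpl exponent. destruct (excluded_middle_informative (rational x)) as [Hr|Hr].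
  - destruct (Hrat Hr) as [N HN].
    apply is_LimSup_seq_close with (k := 0%nat) (v := fun _ => 0).
    2:{ intros eps. assert (He := cond_pos eps). split.
        - intros M. exists M. split; [lia|lra].
        - exists 0%nat. intros; lra. }
    (* 4K comes from the comparison of [u] with the word sum, 4K + 2KN from
       [word_sum_eventually_V]. *)
    apply is_lim_seq_0_le_sqrt with (a := 2 * K * INR N) (b := 8 * K + 2 * K * INR N)
      (N := S (i + j + N)).
    intros n Hn. rewrite Nat.add_0_r, Rminus_0_r.
    specialize (Hclose n ltac:(lia)).
    assert (H1 := word_sum_eventually_V K phi psi K_ge0 phi_arc psi_arc s N n HN ltac:(lia)).
    assert (H2 := word_sum_bounds K phi psi K_ge0 phi_arc psi_arc (prefix s n)).
    assert (Hp : 0 < INR n) by (apply lt_0_INR; lia).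
    unfold Rdiv. rewrite Rabs_mult, Rabs_inv, (Rabs_pos_eq (INR n)) by lra.
    apply Rmult_le_compat_r; [now apply Rlt_le, Rinv_0_lt_compat|].
    apply Rabs_le_between in Hclose. apply Rabs_le. lra.
  - rewrite Rabs_pos_eq by lra.
    apply is_LimSup_seq_close with (k := 0%nat) (2 := farey_exponent_spec x).
    apply is_lim_seq_0_le_sqrt with (a := 0) (b := 4 * K) (N := S (i + j)).
    intros n Hn. rewrite Nat.add_0_r, <- (farey_letters_unique x s Hx Hr Hlim).
    assert (Hp : 0 < INR n) by (apply lt_0_INR; lia).
    unfold Rdiv. rewrite <- Rmult_minus_distr_r, Rabs_mult, Rabs_inv, (Rabs_pos_eq (INR n)) by lra.
    apply Rmult_le_compat_r; [now apply Rlt_le, Rinv_0_lt_compat|].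
    rewrite Rplus_0_l. now apply Hclose.
Qed.

End Exponent.

(** * Goursat's theorem on rectangles *)

(* The Cauchy-Riemann equations for [P + i Q]. *)
Definition holomorphic_pair (P Q : R -> R -> R) : Prop :=
  forall x y, 0 < y -> exists al be,
    differentiable_pt_lim P x y al (- be) /\ differentiable_pt_lim Q x y be al.

Lemma differentiable_pt_lim_continuous_1 (P : R -> R -> R) (x y a b : R) :
  differentiable_pt_lim P x y a b -> continuous (fun s => P s y) x.
Proof.
  intros H. apply (@ex_derive_continuous R_AbsRing R_NormedModule).
  exists (a * 1 + b * 0). apply is_derive_Reals.
  apply (derivable_pt_lim_comp_2d P (fun s => s) (fun _ => y)); trivial.
  - apply derivable_pt_lim_id.
  - apply derivable_pt_lim_const.
Qed.

Lemma differentiable_pt_lim_continuous_2 (P : R -> R -> R) (x y a b : R) :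
  differentiable_pt_lim P x y a b -> continuous (fun s => P x s) y.
Proof.
  intros H. apply (@ex_derive_continuous R_AbsRing R_NormedModule).
  exists (a * 0 + b * 1). apply is_derive_Reals.
  apply (derivable_pt_lim_comp_2d P (fun _ => x) (fun s => s)); trivial.
  - apply derivable_pt_lim_const.
  - apply derivable_pt_lim_id.
Qed.

(** The increment is at most 1 + |a| + |b| times the larger coordinate increment, which gives joint
    continuity. *)
Lemma differentiable_pt_lim_locally_bounded (P : R -> R -> R) (x y a b : R) (eps : posreal) :
  differentiable_pt_lim P x y a b ->
  locally_2d (fun u v => Rabs (P u v - P x y) < eps) x y.
Proof.
  intros H. destruct (H (mkposreal 1 Rlt_0_1)) as [d Hd]. cbn in Hd.
  set (K := 1 + Rabs a + Rabs b).
  assert (HK : 0 < K) by (unfold K; generalize (Rabs_pos a) (Rabs_pos b); lra).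
  assert (He : 0 < Rmin d (eps / K)).
  { apply Rmin_pos; [apply cond_pos|]. apply Rdiv_lt_0_compat; [apply cond_pos|lra]. }
  exists (mkposreal _ He). cbn. intros u v Hu Hv.
  assert (Hu1 := Rlt_le_trans _ _ _ Hu (Rmin_l _ _)).
  assert (Hv1 := Rlt_le_trans _ _ _ Hv (Rmin_l _ _)).
  assert (Hu2 := Rlt_le_trans _ _ _ Hu (Rmin_r _ _)).
  assert (Hv2 := Rlt_le_trans _ _ _ Hv (Rmin_r _ _)).
  specialize (Hd u v Hu1 Hv1).
  set (m := Rmax (Rabs (u - x)) (Rabs (v - y))) in *.
  assert (Hm : m < eps / K) by (unfold m; apply Rmax_lub_lt; lra).
  assert (Hmu : Rabs (u - x) <= m) by apply Rmax_l.
  assert (Hmv : Rabs (v - y) <= m) by apply Rmax_r.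
  assert (HmK : m * K < eps).
  { apply Rlt_le_trans with (eps / K * K); [apply Rmult_lt_compat_r; lra|].
    apply Req_le. field. lra. }
  replace (P u v - P x y) with
    ((P u v - P x y - (a * (u - x) + b * (v - y))) + (a * (u - x) + b * (v - y))) by ring.
  eapply Rle_lt_trans; [apply Rabs_triang|].
  eapply Rle_lt_trans; [apply Rplus_le_compat_l, Rabs_triang|].
  rewrite !Rabs_mult. unfold K in HmK.
  generalize (Rabs_pos a) (Rabs_pos b) (Rabs_pos (u-x)) (Rabs_pos (v-y)); intros.
  nra.
Qed.

Section Rectangles.

Variables (P Q : R -> R -> R).
Hypothesis PQ_hol : holomorphic_pair P Q.

(** The integral of P dx - Q dy, the real part of (P + i Q) dz, around the rectangle;
    counterclockwise when x1 < x2 and y1 < y2. *)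
Let circulation x1 x2 y1 y2 :=
  RInt (fun s => P s y1) x1 x2 - RInt (fun s => P s y2) x1 x2
  + RInt (fun s => Q x1 s) y1 y2 - RInt (fun s => Q x2 s) y1 y2.

Lemma ex_RInt_horizontal y a b : 0 < y -> ex_RInt (fun s => P s y) a b.
Proof.
  intros Hy. apply (@ex_RInt_continuous R_CompleteNormedModule). intros z _.
  destruct (PQ_hol z y Hy) as (al & be & H & _).
  exact (differentiable_pt_lim_continuous_1 P z y _ _ H).
Qed.

Lemma ex_RInt_vertical x c d : 0 < c -> 0 < d -> ex_RInt (fun s => Q x s) c d.
Proof.
  intros Hc Hd. apply (@ex_RInt_continuous R_CompleteNormedModule). intros z [Hz _].
  assert (0 < z) by (apply Rlt_le_trans with (Rmin c d); [now apply Rmin_pos | exact Hz]).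
  destruct (PQ_hol x z) as (al & be & _ & H'); trivial.
  exact (differentiable_pt_lim_continuous_2 Q x z _ _ H').
Qed.

Lemma horizontal_Chasles y a b c : 0 < y ->
  RInt (fun s => P s y) a c = RInt (fun s => P s y) a b + RInt (fun s => P s y) b c.
Proof.
  intros Hy. symmetry.
  apply (RInt_Chasles (V := R_CompleteNormedModule)); apply ex_RInt_horizontal; trivial.
Qed.

Lemma vertical_Chasles x a b c : 0 < a -> 0 < b -> 0 < c ->
  RInt (fun s => Q x s) a c = RInt (fun s => Q x s) a b + RInt (fun s => Q x s) b c.
Proof.
  intros Ha Hb Hc. symmetry.
  apply (RInt_Chasles (V := R_CompleteNormedModule)); apply ex_RInt_vertical; trivial.
Qed.

Lemma circulation_quarters x1 x2 x3 y1 y2 y3 : 0 < y1 -> 0 < y2 -> 0 < y3 ->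
  circulation x1 x3 y1 y3 =
  circulation x1 x2 y1 y2 + circulation x2 x3 y1 y2
  + circulation x1 x2 y2 y3 + circulation x2 x3 y2 y3.
Proof.
  intros H1 H2 H3. unfold circulation.
  rewrite (horizontal_Chasles y1 x1 x2 x3), (horizontal_Chasles y3 x1 x2 x3) by trivial.
  rewrite (vertical_Chasles x1 y1 y2 y3), (vertical_Chasles x3 y1 y2 y3) by trivial.
  ring.
Qed.

(** By the Cauchy-Riemann equations the first-order parts of P and Q have circulation 0, so only the
    error terms of differentiability remain. *)
Lemma circulation_small x0 y0 eps : 0 < y0 -> 0 < eps ->
  exists delta, 0 < delta /\
  forall x1 x2 y1 y2, 0 < y1 -> x1 <= x0 <= x2 -> y1 <= y0 <= y2 ->
    x2 - x1 < delta -> y2 - y1 < delta ->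
    Rabs (circulation x1 x2 y1 y2) <= eps * (((x2 - x1) + (y2 - y1)) ^ 2).
Proof.
  intros Hy0 Heps.
  assert (He2 : 0 < eps / 2) by lra.
  destruct (PQ_hol x0 y0 Hy0) as (al & be & HP & HQ).
  destruct (HP (mkposreal _ He2)) as [d1 Hd1]. destruct (HQ (mkposreal _ He2)) as [d2 Hd2].
  cbn in Hd1, Hd2.
  exists (Rmin d1 d2). split; [apply Rmin_pos; apply cond_pos|].
  intros x1 x2 y1 y2 Hy1 Hx Hy Hdx Hdy.
  assert (A1 := Rmin_l d1 d2). assert (A2 := Rmin_r d1 d2).
  set (L := (x2 - x1) + (y2 - y1)).
  assert (EP : forall s t, x1 <= s <= x2 -> y1 <= t <= y2 ->
     Rabs (P s t - P x0 y0 - (al * (s - x0) + - be * (t - y0))) <= eps / 2 * L).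
  { intros s t Hs Ht. eapply Rle_trans; [apply Hd1|].
    - apply Rabs_def1; lra.
    - apply Rabs_def1; lra.
    - apply Rmult_le_compat_l; [lra|]. unfold L. apply Rmax_lub; apply Rabs_le; lra. }
  assert (EQ : forall s t, x1 <= s <= x2 -> y1 <= t <= y2 ->
     Rabs (Q s t - Q x0 y0 - (be * (s - x0) + al * (t - y0))) <= eps / 2 * L).
  { intros s t Hs Ht. eapply Rle_trans; [apply Hd2|].
    - apply Rabs_def1; lra.
    - apply Rabs_def1; lra.
    - apply Rmult_le_compat_l; [lra|]. unfold L. apply Rmax_lub; apply Rabs_le; lra. }
  assert (exP1 := ex_RInt_horizontal y1 x1 x2 ltac:(lra)).
  assert (exP2 := ex_RInt_horizontal y2 x1 x2 ltac:(lra)).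
  assert (exQ1 := ex_RInt_vertical x1 y1 y2 ltac:(lra) ltac:(lra)).
  assert (exQ2 := ex_RInt_vertical x2 y1 y2 ltac:(lra) ltac:(lra)).
  (* [k] and [k'] are the first-order differences across the rectangle, and (x2 - x1) k + (y2 - y1)
     k' = 0. *)
  set (k := be * (y2 - y1)). set (k' := - be * (x2 - x1)).
  assert (I1 : Rabs (RInt (fun s => P s y1 - P s y2 - k) x1 x2) <= (x2 - x1) * (eps * L)).
  { apply abs_RInt_le_const; [lra| |].
    - apply (@ex_RInt_minus R_NormedModule); [|apply ex_RInt_const].
      now apply (@ex_RInt_minus R_NormedModule).
    - intros s Hs. unfold k.
      assert (B1 := EP s y1 Hs ltac:(lra)). assert (B2 := EP s y2 Hs ltac:(lra)).
      apply Rabs_le. apply Rabs_le_between in B1. apply Rabs_le_between in B2. lra. }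
  assert (I2 : Rabs (RInt (fun s => Q x1 s - Q x2 s - k') y1 y2) <= (y2 - y1) * (eps * L)).
  { apply abs_RInt_le_const; [lra| |].
    - apply (@ex_RInt_minus R_NormedModule); [|apply ex_RInt_const].
      now apply (@ex_RInt_minus R_NormedModule).
    - intros s Hs. unfold k'.
      assert (B1 := EQ x1 s ltac:(lra) Hs). assert (B2 := EQ x2 s ltac:(lra) Hs).
      apply Rabs_le. apply Rabs_le_between in B1. apply Rabs_le_between in B2. lra. }
  assert (J1 : RInt (fun s => P s y1 - P s y2 - k) x1 x2 =
    RInt (fun s => P s y1) x1 x2 - RInt (fun s => P s y2) x1 x2 - (x2 - x1) * k).
  { rewrite (RInt_minus (V := R_CompleteNormedModule) (fun s => P s y1 - P s y2) (fun _ => k)).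
    - rewrite (RInt_minus (V := R_CompleteNormedModule) (fun s => P s y1) (fun s => P s y2)) by trivial.
      rewrite RInt_const. reflexivity.
    - now apply (@ex_RInt_minus R_NormedModule).
    - apply ex_RInt_const. }
  assert (J2 : RInt (fun s => Q x1 s - Q x2 s - k') y1 y2 =
    RInt (fun s => Q x1 s) y1 y2 - RInt (fun s => Q x2 s) y1 y2 - (y2 - y1) * k').
  { rewrite (RInt_minus (V := R_CompleteNormedModule) (fun s => Q x1 s - Q x2 s) (fun _ => k')).
    - rewrite (RInt_minus (V := R_CompleteNormedModule) (fun s => Q x1 s) (fun s => Q x2 s)) by trivial.
      rewrite RInt_const. reflexivity.
    - now apply (@ex_RInt_minus R_NormedModule).
    - apply ex_RInt_const. }
  replace (circulation x1 x2 y1 y2) with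
    (RInt (fun s => P s y1 - P s y2 - k) x1 x2 + RInt (fun s => Q x1 s - Q x2 s - k') y1 y2)
    by (rewrite J1, J2; unfold circulation, k, k'; ring).
  eapply Rle_trans; [apply Rabs_triang|].
  eapply Rle_trans; [apply Rplus_le_compat; eassumption|].
  apply Req_le. unfold L. ring.
Qed.

(** If all four quarters met the bound proportional to their area, so would the whole rectangle,
    because the four bounds add up to its own. *)
Lemma circulation_bisect (eps x y l m : R) : 0 < y -> 0 < m ->
  eps * (l * m) < Rabs (circulation x (x + l) y (y + m)) ->
  exists x' y', (x' = x \/ x' = x + l / 2) /\ (y' = y \/ y' = y + m / 2) /\
    eps * (l / 2 * (m / 2)) < Rabs (circulation x' (x' + l / 2) y' (y' + m / 2)).
Proof.
  intros Hy Hm H.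
  rewrite (circulation_quarters x (x + l / 2) (x + l) y (y + m / 2) (y + m)) in H by lra.
  apply NNPP. intros Hn.
  assert (Hall : forall x' y', (x' = x \/ x' = x + l / 2) -> (y' = y \/ y' = y + m / 2) ->
    Rabs (circulation x' (x' + l / 2) y' (y' + m / 2)) <= eps * (l / 2 * (m / 2))).
  { intros x' y' Hx' Hy'. apply Rnot_lt_le. intros Hlt. apply Hn. now exists x', y'. }
  assert (A1 := Hall x y ltac:(now left) ltac:(now left)).
  assert (A2 := Hall (x + l / 2) y ltac:(now right) ltac:(now left)).
  assert (A3 := Hall x (y + m / 2) ltac:(now left) ltac:(now right)).
  assert (A4 := Hall (x + l / 2) (y + m / 2) ltac:(now right) ltac:(now right)).
  replace (x + l / 2 + l / 2) with (x + l) in * by field.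
  replace (y + m / 2 + m / 2) with (y + m) in * by field.
  apply Rabs_le_between in A1. apply Rabs_le_between in A2.
  apply Rabs_le_between in A3. apply Rabs_le_between in A4.
  apply (Rlt_irrefl (eps * (l * m))). eapply Rlt_le_trans; [exact H|].
  apply Rabs_le. lra.
Qed.

Lemma nested_interval_limit (a : nat -> R) (l : R) : 0 <= l ->
  (forall n, a (S n) = a n \/ a (S n) = a n + l / 2 ^ n / 2) ->
  exists s, forall n, a n <= s <= a n + l / 2 ^ n.
Proof.
  intros Hl Ha.
  assert (Hpos : forall n, 0 <= l / 2 ^ n).
  { intros n. apply Rdiv_le_0_compat; [lra|]. apply pow_lt; lra. }
  assert (Hhalf : forall n, l / 2 ^ S n = l / 2 ^ n / 2).
  { intros n. simpl. field. apply pow_nonzero; lra. }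
  assert (Hinc : forall n, a n <= a (S n)) by (intros n; specialize (Hpos n); destruct (Ha n); lra).
  assert (Hdec : forall n, a (S n) + l / 2 ^ S n <= a n + l / 2 ^ n).
  { intros n. specialize (Hpos n). rewrite Hhalf. destruct (Ha n); lra. }
  assert (Hdec' : forall n k, a (n + k)%nat + l / 2 ^ (n + k) <= a n + l / 2 ^ n).
  { intros n k. induction k as [|k IH]; [rewrite Nat.add_0_r; lra|].
    rewrite Nat.add_succ_r. eapply Rle_trans; [apply Hdec|apply IH]. }
  destruct (ex_finite_lim_seq_incr a (a 0%nat + l / 2 ^ 0)) as [s Hs]; trivial.
  { intros n. generalize (Hdec' 0%nat n) (Hpos n). simpl. lra. }
  exists s. intros n. split.
  - now apply (is_lim_seq_incr_compare a).
  - apply (is_lim_seq_le (fun k => a (k + n)%nat) (fun _ => a n + l / 2 ^ n) s (a n + l / 2 ^ n)).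
    + intros k. rewrite Nat.add_comm. generalize (Hdec' n k) (Hpos (n + k)%nat). lra.
    + now apply -> is_lim_seq_incr_n.
    + apply is_lim_seq_const.
Qed.

Lemma circulation_eq0_pos x y l m : 0 < y -> 0 < l -> 0 < m ->
  circulation x (x + l) y (y + m) = 0.
Proof.
  intros Hy Hl Hm. apply NNPP. intros Hne.
  assert (Hc : 0 < Rabs (circulation x (x + l) y (y + m))) by now apply Rabs_pos_lt.
  (* Half the circulation per unit area, so that the starting rectangle exceeds the threshold
     strictly. *)
  set (eps := Rabs (circulation x (x + l) y (y + m)) / (2 * (l * m))).
  assert (Hlm : 0 < l * m) by (apply Rmult_lt_0_compat; lra).
  assert (Heps : 0 < eps) by (unfold eps; apply Rdiv_lt_0_compat; lra).
  pose (bad := fun (n : nat) (p : R * R) =>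
    eps * (l / 2 ^ n * (m / 2 ^ n)) <
    Rabs (circulation (fst p) (fst p + l / 2 ^ n) (snd p) (snd p + m / 2 ^ n))).
  pose (child := fun (n : nat) (p p' : R * R) =>
    (fst p' = fst p \/ fst p' = fst p + l / 2 ^ n / 2) /\
    (snd p' = snd p \/ snd p' = snd p + m / 2 ^ n / 2) /\
    bad (S n) p').
  (* The child is chosen by [epsilon]; its property is available only once the current rectangle is
     known to be bad, so both are proved in one induction. *)
  pose (step := fun (n : nat) (p : R * R) => epsilon (inhabits p) (child n p)).
  pose (corner := fix corner n := match n with O => (x, y) | S n => step n (corner n) end).
  assert (H2 : forall n, 0 < 2 ^ n) by (intros; apply pow_lt; lra).
  assert (Hbad : forall n, 0 < snd (corner n) /\ bad n (corner n) /\ child n (corner n) (corner (S n))).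
  { assert (Hstep : forall n, 0 < snd (corner n) -> bad n (corner n) ->
        child n (corner n) (corner (S n))).
    { intros n Hs Hb. change (corner (S n)) with (step n (corner n)). unfold step.
      apply epsilon_spec. unfold bad in Hb.
      assert (Hml : 0 < m / 2 ^ n) by (apply Rdiv_lt_0_compat; trivial).
      destruct (circulation_bisect _ _ _ _ _ Hs Hml Hb) as (x' & y' & Hx' & Hy' & Hb').
      exists (x', y'). unfold child, bad. cbn [fst snd].
      replace (l / 2 ^ S n) with (l / 2 ^ n / 2) by (simpl; field; apply pow_nonzero; lra).
      replace (m / 2 ^ S n) with (m / 2 ^ n / 2) by (simpl; field; apply pow_nonzero; lra).
      tauto. }
    induction n as [|n IH].
    - assert (Hb0 : bad 0%nat (corner 0%nat)).
      { unfold bad. cbn. rewrite !Rdiv_1_r. unfold eps.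
        apply Rle_lt_trans with (Rabs (circulation x (x + l) y (y + m)) / 2); [|lra].
        apply Req_le. field. lra. }
      split; [exact Hy|]. split; [exact Hb0|]. now apply Hstep.
    - destruct IH as (Hs & Hb & Hchild).
      assert (Hs' : 0 < snd (corner (S n))).
      { destruct Hchild as (_ & [-> | ->] & _); trivial.
        assert (0 < m / 2 ^ n) by (apply Rdiv_lt_0_compat; trivial). lra. }
      assert (Hb' : bad (S n) (corner (S n))) by apply Hchild.
      split; [exact Hs'|]. split; [exact Hb'|]. now apply Hstep. }
  destruct (nested_interval_limit (fun n => fst (corner n)) l) as [x0 Hx0]; [lra| |].
  { intros n. apply (proj2 (proj2 (Hbad n))). }
  destruct (nested_interval_limit (fun n => snd (corner n)) m) as [y0 Hy0]; [lra| |].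
  { intros n. apply (proj2 (proj2 (Hbad n))). }
  cbn beta in Hx0, Hy0.
  assert (Hy0p : 0 < y0) by (specialize (Hy0 0%nat); cbn in Hy0; lra).
  (* Chosen so that e'(l + m)^2 = eps l m. Both sides scale by 4^-n, so the estimate around the
     limit point contradicts badness at a late stage. *)
  set (e' := eps * (l * m) / ((l + m) ^ 2)).
  assert (He' : 0 < e').
  { apply Rdiv_lt_0_compat; [now apply Rmult_lt_0_compat|]. apply pow_lt; lra. }
  destruct (circulation_small x0 y0 e' Hy0p He') as (d & Hd & Hsmall).
  assert (Hlim : exists n, (l + m) / 2 ^ n < d).
  { destruct (pow_lt_1_zero (1 / 2) ltac:(rewrite Rabs_pos_eq; lra) (d / (l + m))
      ltac:(apply Rdiv_lt_0_compat; lra)) as [n Hn].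
    exists n. specialize (Hn n (Nat.le_refl n)).
    rewrite Rabs_pos_eq in Hn by (apply pow_le; lra).
    apply (Rmult_lt_compat_r (l + m)) in Hn; [|lra].
    replace (d / (l + m) * (l + m)) with d in Hn by (field; lra).
    eapply Rle_lt_trans; [|exact Hn]. apply Req_le.
    unfold Rdiv. rewrite Rmult_1_l, pow_inv. ring. }
  destruct Hlim as [n Hn].
  destruct (Hbad n) as (Hs & Hb & _). unfold bad in Hb.
  assert (Hln : 0 < l / 2 ^ n) by (apply Rdiv_lt_0_compat; trivial).
  assert (Hmn : 0 < m / 2 ^ n) by (apply Rdiv_lt_0_compat; trivial).
  assert (Hsum : (l + m) / 2 ^ n = l / 2 ^ n + m / 2 ^ n) by (unfold Rdiv; ring).
  apply (Rlt_irrefl (eps * (l / 2 ^ n * (m / 2 ^ n)))).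
  eapply Rlt_le_trans; [exact Hb|].
  eapply Rle_trans; [apply Hsmall|]; trivial; try lra.
  unfold e'. apply Req_le. field. split; [apply pow_nonzero; lra|lra].
Qed.

Lemma circulation_swap_x x1 x2 y1 y2 : 0 < y1 -> 0 < y2 ->
  circulation x2 x1 y1 y2 = - circulation x1 x2 y1 y2.
Proof.
  intros H1 H2. unfold circulation.
  rewrite <- (opp_RInt_swap (V := R_CompleteNormedModule) (fun s => P s y1) x1 x2) by now apply ex_RInt_horizontal.
  rewrite <- (opp_RInt_swap (V := R_CompleteNormedModule) (fun s => P s y2) x1 x2) by now apply ex_RInt_horizontal.
  unfold opp; simpl. ring.
Qed.

Lemma circulation_swap_y x1 x2 y1 y2 : 0 < y1 -> 0 < y2 ->
  circulation x1 x2 y2 y1 = - circulation x1 x2 y1 y2.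
Proof.
  intros H1 H2. unfold circulation.
  rewrite <- (opp_RInt_swap (V := R_CompleteNormedModule) (fun s => Q x1 s) y1 y2) by now apply ex_RInt_vertical.
  rewrite <- (opp_RInt_swap (V := R_CompleteNormedModule) (fun s => Q x2 s) y1 y2) by now apply ex_RInt_vertical.
  unfold opp; simpl. ring.
Qed.

(** Corners in any order are needed because the primitive is differentiated in all directions. *)
Lemma circulation_eq0 x1 x2 y1 y2 : 0 < y1 -> 0 < y2 -> circulation x1 x2 y1 y2 = 0.
Proof.
  intros H1 H2.
  assert (Hdeg : forall x, circulation x x y1 y2 = 0).
  { intros x. unfold circulation. rewrite !RInt_point. unfold zero; simpl. ring. }
  assert (Hdeg' : forall x x' y, circulation x x' y y = 0).
  { intros x x' y. unfold circulation. rewrite !RInt_point. unfold zero; simpl. ring. }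
  assert (Hpos : forall x1 x2 y1 y2, 0 < y1 -> x1 < x2 -> y1 < y2 -> circulation x1 x2 y1 y2 = 0).
  { intros a b c d Hc Hab Hcd.
    replace b with (a + (b - a)) by ring. replace d with (c + (d - c)) by ring.
    apply circulation_eq0_pos; lra. }
  destruct (Rtotal_order x1 x2) as [Hx|[->|Hx]]; [| apply Hdeg |];
  destruct (Rtotal_order y1 y2) as [Hy|[->|Hy]]; try apply Hdeg'.
  - now apply Hpos.
  - rewrite circulation_swap_y by trivial. rewrite Hpos by trivial. ring.
  - rewrite circulation_swap_x by trivial. rewrite Hpos by trivial. ring.
  - rewrite circulation_swap_x, circulation_swap_y by trivial. rewrite Hpos by trivial. ring.
Qed.

Lemma Rabs_RInt_sub_const_le (g : R -> R) (a b k e : R) :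
  ex_RInt g a b -> (forall s, Rmin a b <= s <= Rmax a b -> Rabs (g s - k) <= e) ->
  Rabs (RInt g a b - k * (b - a)) <= e * Rabs (b - a).
Proof.
  intros Hg Hb.
  assert (HI : is_RInt (fun s => g s - k) a b (RInt g a b - k * (b - a))).
  { replace (k * (b - a)) with (scal (b - a) k) by (unfold scal; simpl; unfold mult; simpl; ring).
    apply (@is_RInt_minus R_NormedModule).
    - now apply (RInt_correct (V := R_CompleteNormedModule)).
    - apply (@is_RInt_const R_NormedModule). }
  rewrite (Rmult_comm e). exact (norm_RInt_le_const_abs (V := R_NormedModule) _ _ _ _ _ Hb HI).
Qed.

(** The primitive integrates horizontally from (0, 1) to (x, 1) and then vertically to (x, y), which
    stays in the upper half plane. *)
Lemma holomorphic_pair_primitive :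
  exists U : R -> R -> R,
    forall x y, 0 < y -> differentiable_pt_lim U x y (P x y) (- Q x y).
Proof.
  exists (fun x y => RInt (fun s => P s 1) 0 x - RInt (fun s => Q x s) 1 y).
  intros x y Hy eps.
  assert (He2 : 0 < eps / 2) by (generalize (cond_pos eps); lra).
  destruct (PQ_hol x y Hy) as (al & be & HP & HQ).
  destruct (differentiable_pt_lim_locally_bounded _ _ _ _ _ (mkposreal _ He2) HP) as [d1 Hd1].
  destruct (differentiable_pt_lim_locally_bounded _ _ _ _ _ (mkposreal _ He2) HQ) as [d2 Hd2].
  cbn in Hd1, Hd2.
  assert (Hd : 0 < Rmin y (Rmin d1 d2)).
  { apply Rmin_pos; trivial. apply Rmin_pos; apply cond_pos. }
  exists (mkposreal _ Hd). cbn [pos]. intros u v Hu Hv.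
  assert (A1 := Rmin_l y (Rmin d1 d2)). assert (A2 := Rmin_r y (Rmin d1 d2)).
  assert (A3 := Rmin_l d1 d2). assert (A4 := Rmin_r d1 d2).
  assert (Hvp : 0 < v) by (apply Rabs_def2 in Hv; lra).
  (* Vanishing circulation between the heights 1 and y turns the increment into an integral from (x,
     y) to (u, y) and on to (u, v), close to the point of differentiation. *)
  assert (C0 := circulation_eq0 x u 1 y Rlt_0_1 Hy). unfold circulation in C0.
  rewrite (horizontal_Chasles 1 0 x u) by lra.
  rewrite (vertical_Chasles u 1 y v) by lra.
  assert (Hbet : forall a b s t, Rmin a b <= s <= Rmax a b -> Rabs (b - a) < t -> Rabs (s - a) < t).
  { intros a b s t Hs Ht. eapply Rle_lt_trans; [|exact Ht].
    revert Hs. unfold Rmin, Rmax, Rabs. destruct (Rle_dec a b); intros;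
    destruct (Rcase_abs (s - a)); destruct (Rcase_abs (b - a)); lra. }
  assert (B1 : Rabs (RInt (fun s => P s y) x u - P x y * (u - x)) <= eps / 2 * Rabs (u - x)).
  { apply Rabs_RInt_sub_const_le; [now apply ex_RInt_horizontal|].
    intros s Hs. apply Rlt_le, Hd1.
    - eapply Hbet; [exact Hs|lra].
    - rewrite Rminus_diag, Rabs_R0. apply cond_pos. }
  assert (B2 : Rabs (RInt (fun s => Q u s) y v - Q x y * (v - y)) <= eps / 2 * Rabs (v - y)).
  { apply Rabs_RInt_sub_const_le; [now apply ex_RInt_vertical|].
    intros s Hs. apply Rlt_le, Hd2; [lra|]. eapply Hbet; [exact Hs|lra]. }
  assert (M1 := Rmax_l (Rabs (u - x)) (Rabs (v - y))).
  assert (M2 := Rmax_r (Rabs (u - x)) (Rabs (v - y))).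
  set (M := Rmax (Rabs (u - x)) (Rabs (v - y))) in *.
  apply Rabs_le. apply Rabs_le_between in B1. apply Rabs_le_between in B2.
  assert (eps / 2 * Rabs (u - x) <= eps / 2 * M) by (apply Rmult_le_compat_l; lra).
  assert (eps / 2 * Rabs (v - y) <= eps / 2 * M) by (apply Rmult_le_compat_l; lra).
  lra.
Qed.

End Rectangles.

(** * Integrals along the arc *)

(** For z = exp(i t) and e = 1 or -1 the denominator is |z - e x|^2. The kernel is Re (i z / (z -
    x)) for e = 1 and - Re (i z / (z + x)) for e = -1. *)
Definition arc_kernel (e x t : R) : R := x * sin t / (1 - 2 * x * (e * cos t) + x * x).

Definition arc_integral (g : R -> R) (e x : R) : R :=
  RInt (fun t => g t * arc_kernel e x t) (PI / 3) (2 * PI / 3).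

Lemma arc_bounds t : PI / 3 <= t <= 2 * PI / 3 ->
  - (1 / 2) <= cos t <= 1 / 2 /\ 0 <= sin t <= 1.
Proof.
  intros Ht. assert (HPI := PI_RGT_0). repeat split.
  - replace (- (1 / 2)) with (cos (2 * (PI / 3))) by (rewrite cos_2PI3; lra).
    apply cos_decr_1; lra.
  - rewrite <- cos_PI3. apply cos_decr_1; lra.
  - apply sin_ge_0; lra.
  - apply SIN_bound.
Qed.

(** Since |e c| <= 1/2, the right side is at least 1 - x + x^2 = (1 + x)^2 / 4 + 3 (1 - x)^2 / 4. *)
Lemma arc_denominator_ge e x c : (e = 1 \/ e = -1) -> 0 <= x -> - (1 / 2) <= c <= 1 / 2 ->
  (1 + x) * (1 + x) / 4 <= 1 - 2 * x * (e * c) + x * x.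
Proof.
  intros He Hx Hc. assert (0 <= (1 - x) * (1 - x)) by apply Rle_0_sqr.
  destruct He as [-> | ->]; nra.
Qed.

(** The difference has numerator (x - y) (1 - x y) sin t with |1 - x y| <= (1 + x)(1 + y); the
    factor 16 is the product of the two 4's from [arc_denominator_ge]. *)
Lemma arc_kernel_lipschitz e x y t : (e = 1 \/ e = -1) -> 0 <= x -> 0 <= y ->
  PI / 3 <= t <= 2 * PI / 3 ->
  Rabs (arc_kernel e x t - arc_kernel e y t) <= 16 * Rabs (x - y) / ((1 + x) * (1 + y)).
Proof.
  intros He Hx Hy Ht. destruct (arc_bounds t Ht) as [Hc Hs]. unfold arc_kernel.
  assert (Dx := arc_denominator_ge e x _ He Hx Hc).
  assert (Dy := arc_denominator_ge e y _ He Hy Hc).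
  set (c := e * cos t) in *. set (s := sin t) in *.
  set (dx := 1 - 2 * x * c + x * x) in *. set (dy := 1 - 2 * y * c + y * y) in *.
  assert (Px : 0 < (1 + x) * (1 + x)) by nra. assert (Py : 0 < (1 + y) * (1 + y)) by nra.
  assert (Pxy : 0 < (1 + x) * (1 + y)) by nra.
  replace (x * s / dx - y * s / dy) with ((x - y) * (s * (1 - x * y)) / (dx * dy)).
  2:{ unfold dx, dy in *. field. split; lra. }
  assert (Hd : 0 < dx * dy) by (apply Rmult_lt_0_compat; lra).
  unfold Rdiv. rewrite Rabs_mult, Rabs_inv, (Rabs_pos_eq (dx * dy)), Rabs_mult by lra.
  assert (H1 : Rabs (s * (1 - x * y)) <= (1 + x) * (1 + y)).
  { rewrite Rabs_mult, (Rabs_pos_eq s) by lra.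
    assert (Rabs (1 - x * y) <= (1 + x) * (1 + y)) by (apply Rabs_le; nra).
    generalize (Rabs_pos (1 - x * y)). nra. }
  assert (H2 : (1 + x) * (1 + y) * ((1 + x) * (1 + y)) <= 16 * (dx * dy)).
  { replace ((1 + x) * (1 + y) * ((1 + x) * (1 + y))) with
      (16 * (((1 + x) * (1 + x) / 4) * ((1 + y) * (1 + y) / 4))) by field.
    apply Rmult_le_compat_l; [lra|]. apply Rmult_le_compat; lra. }
  apply Rmult_le_reg_r with (dx * dy * ((1 + x) * (1 + y))); [nra|].
  replace (Rabs (x - y) * Rabs (s * (1 - x * y)) * / (dx * dy) * (dx * dy * ((1 + x) * (1 + y)))) with
    (Rabs (x - y) * (Rabs (s * (1 - x * y)) * ((1 + x) * (1 + y)))) by (field; lra).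
  replace (16 * Rabs (x - y) * / ((1 + x) * (1 + y)) * (dx * dy * ((1 + x) * (1 + y)))) with
    (Rabs (x - y) * (16 * (dx * dy))) by (field; lra).
  apply Rmult_le_compat_l; [apply Rabs_pos|]. eapply Rle_trans; [|exact H2].
  apply Rmult_le_compat_r; lra.
Qed.

Lemma arc_kernel_ge0 e x t : (e = 1 \/ e = -1) -> 0 <= x -> PI / 3 <= t <= 2 * PI / 3 ->
  0 <= arc_kernel e x t.
Proof.
  intros He Hx Ht. destruct (arc_bounds t Ht) as [Hc Hs]. unfold arc_kernel.
  assert (Dx := arc_denominator_ge e x _ He Hx Hc). apply Rdiv_le_0_compat; nra.
Qed.

Lemma arc_kernel_continuous e x t : (e = 1 \/ e = -1) -> 0 <= x -> PI / 3 <= t <= 2 * PI / 3 ->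
  continuous (arc_kernel e x) t.
Proof.
  intros He Hx Ht. destruct (arc_bounds t Ht) as [Hc Hs]. unfold arc_kernel.
  assert (Dx := arc_denominator_ge e x _ He Hx Hc).
  apply (@ex_derive_continuous R_AbsRing R_NormedModule). auto_derive. nra.
Qed.

Section ArcIntegral.

Variable g : R -> R.
Hypothesis g_cont : forall t, PI / 3 <= t <= 2 * PI / 3 -> continuous g t.
Hypothesis g_ge0 : forall t, PI / 3 <= t <= 2 * PI / 3 -> 0 <= g t.

Lemma PI3_le_2PI3 : PI / 3 <= 2 * PI / 3.
Proof. assert (H := PI_RGT_0). lra. Qed.

Lemma ex_RInt_arc (h : R -> R) : (forall t, PI / 3 <= t <= 2 * PI / 3 -> continuous h t) ->
  ex_RInt h (PI / 3) (2 * PI / 3).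
Proof.
  intros H. apply (@ex_RInt_continuous R_CompleteNormedModule). intros z Hz.
  rewrite Rmin_left, Rmax_right in Hz by apply PI3_le_2PI3. now apply H.
Qed.

Lemma ex_RInt_arc_integrand e x : (e = 1 \/ e = -1) -> 0 <= x ->
  ex_RInt (fun t => g t * arc_kernel e x t) (PI / 3) (2 * PI / 3).
Proof.
  intros He Hx. apply ex_RInt_arc. intros t Ht.
  apply (continuous_mult (K := R_AbsRing)); [now apply g_cont|now apply arc_kernel_continuous].
Qed.

Lemma RInt_arc_ge0 : 0 <= RInt g (PI / 3) (2 * PI / 3).
Proof.
  apply RInt_ge_0; [apply PI3_le_2PI3|now apply ex_RInt_arc|].
  intros t Ht. apply g_ge0. lra.
Qed.

Lemma arc_integral_arc_like e : (e = 1 \/ e = -1) ->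
  arc_like (16 * RInt g (PI / 3) (2 * PI / 3)) (arc_integral g e).
Proof.
  intros He. assert (Hle := PI3_le_2PI3). split; [|split; [|split]].
  - intros x y Hx Hy. unfold arc_integral.
    set (k := 16 * Rabs (x - y) / ((1 + x) * (1 + y))).
    assert (Hxy : 0 < (1 + x) * (1 + y)) by nra.
    assert (H : Rabs (RInt (fun t => g t * arc_kernel e x t) (PI / 3) (2 * PI / 3) -
             RInt (fun t => g t * arc_kernel e y t) (PI / 3) (2 * PI / 3)) <=
             k * RInt g (PI / 3) (2 * PI / 3)).
    { assert (E1 := ex_RInt_arc_integrand e x He Hx). assert (E2 := ex_RInt_arc_integrand e y He Hy).
      rewrite <- (RInt_minus (V := R_CompleteNormedModule)
        (fun t => g t * arc_kernel e x t) (fun t => g t * arc_kernel e y t)) by trivial.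
      assert (E3 : ex_RInt (fun t => minus (g t * arc_kernel e x t) (g t * arc_kernel e y t))
                     (PI / 3) (2 * PI / 3)) by now apply (@ex_RInt_minus R_NormedModule).
      eapply Rle_trans; [apply abs_RInt_le; trivial|].
      change (k * RInt g (PI / 3) (2 * PI / 3)) with (scal k (RInt g (PI / 3) (2 * PI / 3))).
      rewrite <- (RInt_scal (V := R_CompleteNormedModule)) by now apply ex_RInt_arc.
      apply RInt_le; trivial.
      - apply (ex_RInt_norm _ _ _ E3).
      - apply (@ex_RInt_scal R_NormedModule). now apply ex_RInt_arc.
      - intros t Ht. assert (Ht' : PI / 3 <= t <= 2 * PI / 3) by lra.
        assert (L := arc_kernel_lipschitz e x y t He Hx Hy Ht'). fold k in L.
        assert (G := g_ge0 t Ht'). unfold minus, plus, opp, scal, mult; simpl.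
        unfold mult; simpl.
        replace (g t * arc_kernel e x t + - (g t * arc_kernel e y t)) with
          (g t * (arc_kernel e x t - arc_kernel e y t)) by ring.
        rewrite Rabs_mult, (Rabs_pos_eq (g t)), (Rmult_comm k) by trivial.
        now apply Rmult_le_compat_l. }
    apply (Rmult_le_compat_r ((1 + x) * (1 + y))) in H; [|lra].
    eapply Rle_trans; [exact H|]. apply Req_le. unfold k. field. lra.
  - unfold arc_integral. rewrite (RInt_ext _ (fun _ => 0)).
    + rewrite RInt_const. unfold scal; simpl. unfold mult; simpl. ring.
    + intros t _. unfold arc_kernel. unfold Rdiv.
      rewrite !Rmult_0_l. apply Rmult_0_r.
  - intros x Hx. apply RInt_ge_0; trivial; [now apply ex_RInt_arc_integrand|].
    intros t Ht. apply Rmult_le_pos; [apply g_ge0; lra|apply arc_kernel_ge0; trivial; lra].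
  (* The kernel itself is invariant under x -> 1 / x: multiply numerator and denominator by x^2. *)
  - intros x Hx. unfold arc_integral. apply RInt_ext. intros t Ht.
    rewrite Rmin_left, Rmax_right in Ht by trivial. f_equal.
    destruct (arc_bounds t ltac:(lra)) as [Hc Hs]. unfold arc_kernel.
    assert (Dx := arc_denominator_ge e x _ He (Rlt_le _ _ Hx) Hc).
    set (c := e * cos t) in *. field. repeat split; nra.
Qed.

End ArcIntegral.

(** * Complex differentiability *)

(** An epsilon-delta form with linear error, suited to direct estimates by [Cmod]. *)
Definition C_derivative (F : C -> C) (z l : C) : Prop :=
  forall eps, 0 < eps -> exists delta, 0 < delta /\
    forall z', Cmod (z' - z) < delta ->
      Cmod (F z' - F z - (z' - z) * l) <= eps * Cmod (z' - z).

Lemma ex_derive_C_derivative (F : C -> C) (z : C) :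
  @ex_derive C_AbsRing C_NormedModule F z -> exists l, C_derivative F z l.
Proof.
  intros [l [_ H]]. exists l. intros eps Heps.
  destruct (H z (fun P HP => HP) (mkposreal eps Heps)) as [d Hd].
  exists d. split; [apply cond_pos|]. intros z' Hz'. apply (Hd z' Hz').
Qed.

Lemma C_derivative_continuous F z l eps : C_derivative F z l -> 0 < eps ->
  exists delta, 0 < delta /\ forall z', Cmod (z' - z) < delta -> Cmod (F z' - F z) < eps.
Proof.
  intros H Heps. destruct (H 1 Rlt_0_1) as (d & Hd & Hb).
  assert (HK : 0 < 1 + Cmod l) by (generalize (Cmod_ge_0 l); lra).
  exists (Rmin d (eps / (1 + Cmod l))). split.
  { apply Rmin_pos; trivial. now apply Rdiv_lt_0_compat. }
  intros z' Hz'.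
  assert (H1 := Rlt_le_trans _ _ _ Hz' (Rmin_l _ _)).
  assert (H2 := Rlt_le_trans _ _ _ Hz' (Rmin_r _ _)).
  specialize (Hb z' H1). apply (Rmult_lt_compat_r (1 + Cmod l)) in H2; trivial.
  replace (eps / (1 + Cmod l) * (1 + Cmod l)) with eps in H2 by (field; lra).
  replace (F z' - F z)%C with ((F z' - F z - (z' - z) * l) + (z' - z) * l)%C by ring.
  eapply Rle_lt_trans; [apply Cmod_triangle|]. rewrite Cmod_mult. lra.
Qed.

Lemma C_derivative_mult F G z l m : C_derivative F z l -> C_derivative G z m ->
  C_derivative (fun t => F t * G t)%C z (l * G z + F z * m)%C.
Proof.
  intros HF HG eps Heps.
  (* [K] collects the coefficients of e |h| in the four error terms; e <= 1 bounds the product of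
     two small factors by e alone. *)
  set (K := 1 + Cmod (F z) + Cmod (G z) + Cmod m).
  assert (HK : 0 < K).
  { unfold K. generalize (Cmod_ge_0 (F z)) (Cmod_ge_0 (G z)) (Cmod_ge_0 m). lra. }
  set (e := Rmin 1 (eps / K)).
  assert (He : 0 < e) by (apply Rmin_pos; [lra|now apply Rdiv_lt_0_compat]).
  assert (He1 : e <= 1) by apply Rmin_l.
  assert (HeK : e * K <= eps).
  { apply Rle_trans with (eps / K * K); [apply Rmult_le_compat_r; [lra|apply Rmin_r]|].
    apply Req_le. field. lra. }
  destruct (HF e He) as (d1 & Hd1 & H1). destruct (HG e He) as (d2 & Hd2 & H2).
  destruct (C_derivative_continuous F z l e HF He) as (d3 & Hd3 & H3).
  exists (Rmin d1 (Rmin d2 d3)). split; [repeat apply Rmin_pos; trivial|].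
  intros z' Hz'.
  assert (A1 := Rlt_le_trans _ _ _ Hz' (Rmin_l _ _)).
  assert (A2 := Rlt_le_trans _ _ _ (Rlt_le_trans _ _ _ Hz' (Rmin_r _ _)) (Rmin_l _ _)).
  assert (A3 := Rlt_le_trans _ _ _ (Rlt_le_trans _ _ _ Hz' (Rmin_r _ _)) (Rmin_r _ _)).
  specialize (H1 z' A1). specialize (H2 z' A2). specialize (H3 z' A3).
  set (h := (z' - z)%C) in *.
  set (RF := (F z' - F z - h * l)%C) in *. set (RG := (G z' - G z - h * m)%C) in *.
  replace (F z' * G z' - F z * G z - h * (l * G z + F z * m))%C with
    (RF * G z + (F z * RG + ((F z' - F z) * RG + (F z' - F z) * (h * m))))%C.
  2:{ unfold RF, RG. ring. }
  assert (Hh := Cmod_ge_0 h). assert (HRG := Cmod_ge_0 RG).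
  assert (HFz := Cmod_ge_0 (F z)). assert (HGz := Cmod_ge_0 (G z)). assert (Hm := Cmod_ge_0 m).
  assert (HD := Cmod_ge_0 (F z' - F z)).
  eapply Rle_trans; [apply Cmod_triangle|].
  eapply Rle_trans; [apply Rplus_le_compat_l, Cmod_triangle|].
  eapply Rle_trans; [apply Rplus_le_compat_l, Rplus_le_compat_l, Cmod_triangle|].
  rewrite !Cmod_mult.
  assert (B1 : Cmod RF * Cmod (G z) <= e * Cmod h * Cmod (G z)) by now apply Rmult_le_compat_r.
  assert (B2 : Cmod (F z) * Cmod RG <= Cmod (F z) * (e * Cmod h)) by now apply Rmult_le_compat_l.
  assert (B3 : Cmod (F z' - F z) * Cmod RG <= 1 * (e * Cmod h)) by (apply Rmult_le_compat; lra).
  assert (B4 : Cmod (F z' - F z) * (Cmod h * Cmod m) <= e * (Cmod h * Cmod m)).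
  { apply Rmult_le_compat_r; [now apply Rmult_le_pos|lra]. }
  apply Rle_trans with (e * K * Cmod h); [unfold K; lra|].
  now apply Rmult_le_compat_r.
Qed.

Lemma C_derivative_const c z : C_derivative (fun _ => c) z 0.
Proof.
  intros eps Heps. exists 1. split; [lra|]. intros z' _.
  replace (c - c - (z' - z) * 0)%C with (RtoC 0) by ring. rewrite Cmod_0.
  apply Rmult_le_pos; [lra|apply Cmod_ge_0].
Qed.

Lemma C_derivative_inv_sub w z : (z - w <> 0)%C ->
  C_derivative (fun t => / (t - w))%C z (- (/ (z - w) * / (z - w)))%C.
Proof.
  intros Hne eps Heps. set (r := Cmod (z - w)).
  assert (Hr : 0 < r) by now apply Cmod_gt_0.
  assert (Hr3 : 0 < eps * (r * r * r) / 2).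
  { apply Rdiv_lt_0_compat; [|lra]. repeat apply Rmult_lt_0_compat; trivial. }
  (* With h = z' - z the remainder is h^2 / ((z - w)^2 (z' - w)). The first bound keeps |z' - w| >=
     r / 2, the second makes |h| / (r^2 |z' - w|) at most eps. *)
  exists (Rmin (r / 2) (eps * (r * r * r) / 2)). split; [apply Rmin_pos; lra|].
  intros z' Hz'.
  assert (A1 := Rlt_le_trans _ _ _ Hz' (Rmin_l _ _)).
  assert (A2 := Rlt_le_trans _ _ _ Hz' (Rmin_r _ _)).
  assert (Hr' : r / 2 <= Cmod (z' - w)).
  { assert (H : r <= Cmod (z' - w) + Cmod (z' - z)).
    { unfold r. replace (z - w)%C with ((z' - w) + - (z' - z))%C by ring.
      eapply Rle_trans; [apply Cmod_triangle|]. rewrite Cmod_opp. lra. }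
    lra. }
  assert (Hne' : (z' - w <> 0)%C) by (apply Cmod_gt_0; lra).
  replace (/ (z' - w) - / (z - w) - (z' - z) * - (/ (z - w) * / (z - w)))%C with
    ((z' - z) * ((z' - z) * / ((z - w) * (z - w) * (z' - w))))%C by (field; auto).
  assert (Hh := Cmod_ge_0 (z' - z)).
  rewrite Cmod_mult, Rmult_comm. apply Rmult_le_compat_r; trivial.
  rewrite Cmod_mult, Cmod_inv, !Cmod_mult by (repeat apply Cmult_neq_0; trivial).
  fold r. set (h := Cmod (z' - z)) in *. set (r' := Cmod (z' - w)) in *.
  apply Rmult_le_reg_r with (r * r * r'); [repeat apply Rmult_lt_0_compat; lra|].
  replace (h * / (r * r * r') * (r * r * r')) with h by (field; lra).
  apply Rle_trans with (eps * (r * r * r) / 2); [lra|].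
  assert (0 <= eps * (r * r)) by (repeat apply Rmult_le_pos; lra). nra.
Qed.

(** Separating the real and imaginary parts of l h gives the Cauchy-Riemann equations; the factors
    sqrt 2 come from comparing [Cmod] with the maximum norm. *)
Lemma C_derivative_pair F x y l : C_derivative F (x, y) l ->
  differentiable_pt_lim (fun u v => Re (F (u, v))) x y (Re l) (- Im l) /\
  differentiable_pt_lim (fun u v => Im (F (u, v))) x y (Im l) (Re l).
Proof.
  intros H.
  assert (Hs2 : 0 < sqrt 2) by (apply sqrt_lt_R0; lra).
  assert (Hmod : forall u v, Cmod ((u, v) - (x, y)) <= sqrt 2 * Rmax (Rabs (u - x)) (Rabs (v - y))).
  { intros u v. apply (Cmod_2Rmax ((u, v) - (x, y))). }
  assert (Hboth : forall eps : posreal, locally_2d (fun u v =>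
      Rmax (Rabs (Re (F (u, v)) - Re (F (x, y)) - (Re l * (u - x) + - Im l * (v - y))))
           (Rabs (Im (F (u, v)) - Im (F (x, y)) - (Im l * (u - x) + Re l * (v - y))))
      <= eps * Rmax (Rabs (u - x)) (Rabs (v - y))) x y).
  { intros eps. assert (He : 0 < eps / sqrt 2) by (apply Rdiv_lt_0_compat; [apply cond_pos|trivial]).
    destruct (H _ He) as (d & Hd & Hb).
    assert (Hd2 : 0 < d / sqrt 2) by now apply Rdiv_lt_0_compat.
    exists (mkposreal _ Hd2). cbn [pos]. intros u v Hu Hv.
    assert (Hlt : Cmod ((u, v) - (x, y)) < d).
    { eapply Rle_lt_trans; [apply Hmod|].
      replace d with (sqrt 2 * (d / sqrt 2)) by (field; lra).
      apply Rmult_lt_compat_l; trivial. now apply Rmax_lub_lt. }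
    specialize (Hb (u, v) Hlt).
    assert (E : (F (u, v) - F (x, y) - ((u, v) - (x, y)) * l)%C =
      (Re (F (u, v)) - Re (F (x, y)) - (Re l * (u - x) + - Im l * (v - y)),
       Im (F (u, v)) - Im (F (x, y)) - (Im l * (u - x) + Re l * (v - y)))).
    { destruct (F (u, v)) as [p q], (F (x, y)) as [p' q'], l as [a b].
      unfold Cminus, Cplus, Copp, Cmult, Re, Im; simpl. f_equal; ring. }
    rewrite E in Hb.
    eapply Rle_trans; [apply (Rmax_Cmod (_, _))|]. eapply Rle_trans; [exact Hb|].
    eapply Rle_trans; [apply Rmult_le_compat_l; [lra|apply Hmod]|].
    apply Req_le. field. lra. }
  split; intros eps; destruct (Hboth eps) as [d Hd]; exists d; intros u v Hu Hv;
    (eapply Rle_trans; [|apply (Hd u v Hu Hv)]); [apply Rmax_l|apply Rmax_r].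
Qed.

Lemma Re_Im_eq (z1 z2 : C) : Re z1 = Re z2 -> Im z1 = Im z2 -> z1 = z2.
Proof. destruct z1, z2. simpl. now intros -> ->. Qed.

Lemma sub_real_neq0 (z : C) (w : R) : 0 < Im z -> (z - RtoC w <> 0)%C.
Proof.
  intros Hz H. apply (f_equal Im) in H. destruct z as [x y]. simpl in *. lra.
Qed.

Lemma linear_real_neq0 (c d : R) (z : C) : 0 < Im z -> (c <> 0 \/ d <> 0) ->
  (RtoC c * z + RtoC d <> 0)%C.
Proof.
  intros Hz Hcd H. destruct z as [x y].
  assert (H1 := f_equal Re H). assert (H2 := f_equal Im H). simpl in *.
  assert (Hc : c * y = 0) by lra.
  destruct (Rmult_integral _ _ Hc) as [->|]; [|lra]. destruct Hcd as [Hc0|Hd]; [tauto|]. apply Hd. lra.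
Qed.

(* [f(z) sqrt D / Q(z,1)] in terms of the roots [w] and [w'] of [Q(z,1)]. *)
Definition cycle_form (f : C -> C) (w w' : R) (z : C) : C :=
  (f z * (RtoC (w - w') * (/ (z - RtoC w) * / (z - RtoC w'))))%C.

Lemma cycle_form_holomorphic f w w' : holomorphic_on upper_half_plane f ->
  holomorphic_pair (fun x y => Re (cycle_form f w w' (x, y))) (fun x y => Im (cycle_form f w w' (x, y))).
Proof.
  intros Hf x y Hy.
  destruct (ex_derive_C_derivative f (x, y) (Hf (x, y) Hy)) as [l Hl].
  assert (H1 := C_derivative_inv_sub w (x, y) (sub_real_neq0 (x, y) w Hy)).
  assert (H2 := C_derivative_inv_sub w' (x, y) (sub_real_neq0 (x, y) w' Hy)).
  assert (H := C_derivative_mult _ _ _ _ _ Hl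
    (C_derivative_mult _ _ _ _ _ (C_derivative_const (RtoC (w - w')) (x, y))
      (C_derivative_mult _ _ _ _ _ H1 H2))).
  apply (C_derivative_pair (cycle_form f w w')) in H.
  eexists. eexists. exact H.
Qed.

(** * Moebius transformations of the upper half plane *)

Lemma SL2Z_det_R A : SL2Z A -> IZR (m11 A) * IZR (m22 A) - IZR (m12 A) * IZR (m21 A) = 1.
Proof. intros H. rewrite <- !mult_IZR, <- minus_IZR. apply (f_equal IZR H). Qed.

Lemma SL2Z_row2_neq0 A : SL2Z A -> IZR (m21 A) <> 0 \/ IZR (m22 A) <> 0.
Proof.
  intros H. apply SL2Z_det_R in H. destruct (Req_dec (IZR (m21 A)) 0) as [E|E]; [|now left].
  right. intros E'. rewrite E, E' in H. lra.
Qed.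

Lemma moebius_denominator_gt0 A x y : SL2Z A -> 0 < y ->
  0 < (IZR (m21 A) * x + IZR (m22 A)) * (IZR (m21 A) * x + IZR (m22 A))
      + IZR (m21 A) * y * (IZR (m21 A) * y).
Proof.
  intros HA Hy. set (c := IZR (m21 A)). set (d := IZR (m22 A)).
  destruct (Req_dec c 0) as [Hc|Hc].
  - destruct (SL2Z_row2_neq0 A HA) as [H|H]; fold c in H; fold d in H; [tauto|].
    assert (H0 : 0 < d * d) by now apply Rlt_0_sqr. rewrite Hc. lra.
  - assert (Hcy : c * y <> 0) by (apply Rmult_integral_contrapositive_currified; lra).
    assert (H1 : 0 < c * y * (c * y)) by now apply Rlt_0_sqr.
    assert (H2 : 0 <= (c * x + d) * (c * x + d)) by apply Rle_0_sqr. lra.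
Qed.

Lemma moebius_C_Re_Im A x y : SL2Z A ->
  let a := IZR (m11 A) in let b := IZR (m12 A) in let c := IZR (m21 A) in let d := IZR (m22 A) in
  let N := (c * x + d) * (c * x + d) + c * y * (c * y) in
  Re (moebius_C A (x, y)) = ((a * x + b) * (c * x + d) + a * y * (c * y)) / N /\
  Im (moebius_C A (x, y)) = y / N.
Proof.
  intros HA a b c d N. assert (Hdet := SL2Z_det_R A HA). fold a b c d in Hdet.
  unfold moebius_C, Zc. fold a b c d.
  unfold Cdiv, Cinv, Cmult, Cplus, RtoC, Re, Im; simpl.
  assert (HN' : (c * x - 0 * y + d) * ((c * x - 0 * y + d) * 1)
     + (c * y + 0 * x + 0) * ((c * y + 0 * x + 0) * 1) = N) by (unfold N; ring).
  rewrite HN'. clearbody N. split; [unfold Rdiv; ring|].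
  replace (y / N) with ((a * d - b * c) * y / N) by (rewrite Hdet; unfold Rdiv; ring).
  unfold Rdiv. ring.
Qed.

Lemma moebius_C_upper A z : SL2Z A -> upper_half_plane z -> upper_half_plane (moebius_C A z).
Proof.
  intros HA Hz. destruct z as [x y]. unfold upper_half_plane in *. simpl in Hz.
  rewrite (proj2 (moebius_C_Re_Im A x y HA)).
  apply Rdiv_lt_0_compat; trivial. now apply moebius_denominator_gt0.
Qed.

Lemma moebius_C_mul A B z : SL2Z A -> SL2Z B -> upper_half_plane z ->
  moebius_C (mat_mul A B) z = moebius_C A (moebius_C B z).
Proof.
  intros HA HB Hz.
  assert (H1 := linear_real_neq0 _ _ z Hz (SL2Z_row2_neq0 B HB)).
  assert (H2 := linear_real_neq0 _ _ z Hz (SL2Z_row2_neq0 _ (SL2Z_mul A B HA HB))).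
  unfold moebius_C, Zc in *. unfold mat_mul in *. cbn [m11 m12 m21 m22] in *.
  rewrite !plus_IZR, !mult_IZR, !RtoC_plus, !RtoC_mult in *.
  field. split; trivial. intros H. apply H2. rewrite <- H. ring.
Qed.

Lemma moebius_C_id z : moebius_C mat_id z = z.
Proof. unfold moebius_C, Zc, mat_id. cbn [m11 m12 m21 m22]. field. Qed.

(* The relation [w = A u] without division. *)
Definition moebius_rel (A : mat2) (u w : R) : Prop :=
  w * (IZR (m21 A) * u + IZR (m22 A)) = IZR (m11 A) * u + IZR (m12 A).

(** If c u + d = 0, the relation makes a u + b = 0 as well, which is impossible when the determinant
    is 1. *)
Lemma moebius_rel_denominator A u w : SL2Z A -> moebius_rel A u w -> IZR (m21 A) * u + IZR (m22 A) <> 0.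
Proof.
  intros HA H H0. unfold moebius_rel in H. rewrite H0, Rmult_0_r in H.
  assert (Hdet := SL2Z_det_R A HA).
  apply (Rlt_irrefl 0). apply Rlt_le_trans with 1; [lra|].
  rewrite <- Hdet.
  destruct (Req_dec (IZR (m21 A)) 0) as [E|E].
  - rewrite E in *. assert (IZR (m22 A) = 0) by lra. nra.
  - assert (Hu : u = - IZR (m22 A) / IZR (m21 A)).
    { apply (Rmult_eq_reg_r (IZR (m21 A))); trivial. unfold Rdiv.
      rewrite Rmult_assoc, Rinv_l by trivial. lra. }
    apply (f_equal (Rmult (IZR (m21 A)))) in H. rewrite Hu in H.
    replace (IZR (m21 A) * (IZR (m11 A) * (- IZR (m22 A) / IZR (m21 A)) + IZR (m12 A))) with
      (- (IZR (m11 A) * IZR (m22 A) - IZR (m12 A) * IZR (m21 A))) in H by (field; trivial).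
    lra.
Qed.

(** The differential [cycle_form f w w' z] dz pulls back under A to the one with roots A^-1 w and
    A^-1 w'. All three differences obey A z - A u = (z - u) / ((c z + d)(c u + d)), and the factors
    coming from u and u' cancel. *)
Lemma cycle_form_moebius f A u u' w w' z :
  (forall A z, SL2Z A -> upper_half_plane z -> f (moebius_C A z) = f z) ->
  SL2Z A -> moebius_rel A u w -> moebius_rel A u' w' -> upper_half_plane z ->
  (cycle_form f w w' (moebius_C A z) *
     / ((Zc (m21 A) * z + Zc (m22 A)) * (Zc (m21 A) * z + Zc (m22 A))))%C = cycle_form f u u' z.
Proof.
  intros Hf HA Hu Hu' Hz. unfold cycle_form. rewrite Hf by trivial.
  assert (Du := moebius_rel_denominator A u w HA Hu).
  assert (Du' := moebius_rel_denominator A u' w' HA Hu').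
  assert (Dz := linear_real_neq0 _ _ z Hz (SL2Z_row2_neq0 A HA)).
  assert (Zu := sub_real_neq0 z u Hz). assert (Zu' := sub_real_neq0 z u' Hz).
  assert (Hdet := SL2Z_det_R A HA).
  unfold moebius_rel in *. unfold moebius_C, Zc.
  set (a := IZR (m11 A)) in *. set (b := IZR (m12 A)) in *.
  set (c := IZR (m21 A)) in *. set (d := IZR (m22 A)) in *.
  assert (Ew : w = (a * u + b) / (c * u + d)).
  { apply (Rmult_eq_reg_r (c * u + d)); trivial. rewrite Hu. field. trivial. }
  assert (Ew' : w' = (a * u' + b) / (c * u' + d)).
  { apply (Rmult_eq_reg_r (c * u' + d)); trivial. rewrite Hu'. field. trivial. }
  assert (Edet : (RtoC a * RtoC d - RtoC b * RtoC c)%C = RtoC 1).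
  { rewrite <- !RtoC_mult, <- RtoC_minus. now f_equal. }
  assert (Cu : (RtoC c * RtoC u + RtoC d <> 0)%C).
  { rewrite <- RtoC_mult, <- RtoC_plus. intros H0. now apply RtoC_inj in H0. }
  assert (Cu' : (RtoC c * RtoC u' + RtoC d <> 0)%C).
  { rewrite <- RtoC_mult, <- RtoC_plus. intros H0. now apply RtoC_inj in H0. }
  assert (E1 : ((RtoC a * z + RtoC b) / (RtoC c * z + RtoC d) - RtoC w)%C =
    ((z - RtoC u) / ((RtoC c * z + RtoC d) * (RtoC c * RtoC u + RtoC d)))%C).
  { rewrite Ew, RtoC_div, !RtoC_plus, !RtoC_mult by trivial.
    replace (z - RtoC u)%C with ((RtoC a * RtoC d - RtoC b * RtoC c) * (z - RtoC u))%C by (rewrite Edet; ring).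
    field. auto. }
  assert (E2 : ((RtoC a * z + RtoC b) / (RtoC c * z + RtoC d) - RtoC w')%C =
    ((z - RtoC u') / ((RtoC c * z + RtoC d) * (RtoC c * RtoC u' + RtoC d)))%C).
  { rewrite Ew', RtoC_div, !RtoC_plus, !RtoC_mult by trivial.
    replace (z - RtoC u')%C with ((RtoC a * RtoC d - RtoC b * RtoC c) * (z - RtoC u'))%C by (rewrite Edet; ring).
    field. auto. }
  assert (E3 : RtoC (w - w') =
    ((RtoC u - RtoC u') / ((RtoC c * RtoC u + RtoC d) * (RtoC c * RtoC u' + RtoC d)))%C).
  { rewrite RtoC_minus, Ew, Ew', !RtoC_div, !RtoC_plus, !RtoC_mult by trivial.
    replace (RtoC u - RtoC u')%C with ((RtoC a * RtoC d - RtoC b * RtoC c) * (RtoC u - RtoC u'))%C by (rewrite Edet; ring).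
    field. auto. }
  rewrite E1, E2, E3, RtoC_minus. field. repeat split; auto.
Qed.

(** * Periods of words *)

Lemma Cmult_inv_sqr (X Y : R) (v : C) : 0 < X * X + Y * Y ->
  (v * / ((X, Y) * (X, Y)))%C =
    ((Re v * (X * X - Y * Y) + Im v * (2 * X * Y)) / ((X * X + Y * Y) * (X * X + Y * Y)),
     (Im v * (X * X - Y * Y) - Re v * (2 * X * Y)) / ((X * X + Y * Y) * (X * X + Y * Y))).
Proof.
  intros HN. destruct v as [v1 v2].
  assert (HN2 : (X * X - Y * Y) ^ 2 + (X * Y + Y * X) ^ 2 = (X * X + Y * Y) * (X * X + Y * Y)) by ring.
  unfold Cmult, Cinv. cbn [fst snd Re Im]. unfold Re, Im. cbn [fst snd]. rewrite HN2.
  f_equal; unfold Rdiv; ring.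
Qed.

Lemma is_derive_moebius_C A (p q : R -> R) (t p' q' : R) : SL2Z A -> 0 < q t ->
  is_derive p t p' -> is_derive q t q' ->
  let v := ((p', q') * / ((Zc (m21 A) * (p t, q t) + Zc (m22 A)) * (Zc (m21 A) * (p t, q t) + Zc (m22 A))))%C in
  is_derive (fun s => Re (moebius_C A (p s, q s))) t (Re v) /\
  is_derive (fun s => Im (moebius_C A (p s, q s))) t (Im v).
Proof.
  intros HA Hq Hp' Hq' v.
  assert (HN := moebius_denominator_gt0 A (p t) (q t) HA Hq).
  assert (Hdet := SL2Z_det_R A HA).
  assert (Ep : Derive (fun s => p s) t = p') by now apply is_derive_unique.
  assert (Eq : Derive (fun s => q s) t = q') by now apply is_derive_unique.
  assert (Ev : v = ((p', q') * / (((IZR (m21 A) * p t + IZR (m22 A))%R, (IZR (m21 A) * q t)%R)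
                      * ((IZR (m21 A) * p t + IZR (m22 A))%R, (IZR (m21 A) * q t)%R)))%C).
  { unfold v, Zc. do 3 f_equal; unfold Cmult, Cplus, RtoC; simpl; f_equal; ring. }
  rewrite Cmult_inv_sqr in Ev by exact HN.
  assert (Ev1 := f_equal fst Ev). assert (Ev2 := f_equal snd Ev). cbn [fst snd Re Im] in Ev1, Ev2.
  change (fst v) with (Re v) in Ev1. change (snd v) with (Im v) in Ev2.
  rewrite Ev1, Ev2. clear Ev Ev1 Ev2. clearbody v.
  change (Re (p', q')) with p'. change (Im (p', q')) with q'.
  set (a := IZR (m11 A)) in *. set (b := IZR (m12 A)) in *.
  set (c := IZR (m21 A)) in *. set (d := IZR (m22 A)) in *.
  split.
  - apply is_derive_ext with (f := fun s => ((a * p s + b) * (c * p s + d) + a * q s * (c * q s)) /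
      ((c * p s + d) * (c * p s + d) + c * q s * (c * q s))).
    { intros s. symmetry. apply (proj1 (moebius_C_Re_Im A (p s) (q s) HA)). }
    auto_derive.
    + repeat split; try (eexists; eassumption). lra.
    + rewrite Ep, Eq.
      (* Inserting a d - b c = 1 makes both sides equal as rational functions. *)
      match goal with |- _ = ?r => replace r with ((a * d - b * c) * r) by (rewrite Hdet; ring) end.
      field. lra.
  - apply is_derive_ext with (f := fun s => q s /
      ((c * p s + d) * (c * p s + d) + c * q s * (c * q s))).
    { intros s. symmetry. apply (proj2 (moebius_C_Re_Im A (p s) (q s) HA)). }
    auto_derive.
    + repeat split; try (eexists; eassumption). lra.
    + rewrite Ep, Eq. field. lra.
Qed.

Lemma C_exp_arc t : C_exp (Ci * RtoC t) = (cos t, sin t).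
Proof.
  unfold C_exp, Ci, RtoC, Cmult, Re, Im; simpl.
  replace (0 * t - 1 * 0) with 0 by ring. replace (0 * 0 + 1 * t) with t by ring.
  rewrite exp_0. f_equal; ring.
Qed.

Section CyclePeriods.

Variable f : C -> C.
Hypothesis f_hol : holomorphic_on upper_half_plane f.
Hypothesis f_inv : forall A z, SL2Z A -> upper_half_plane z -> f (moebius_C A z) = f z.
Hypothesis f_arc : forall t, PI / 3 <= t <= 2 * PI / 3 ->
  Im (f (cos t, sin t)) = 0 /\ 0 <= Re (f (cos t, sin t)).

Let g t := Re (f (cos t, sin t)).

Lemma arc_upper t : PI / 3 <= t <= 2 * PI / 3 -> 0 < sin t.
Proof. intros Ht. assert (H := PI_RGT_0). apply sin_gt_0; lra. Qed.

Lemma arc_values_continuous t : PI / 3 <= t <= 2 * PI / 3 -> continuous g t.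
Proof.
  intros Ht. destruct (ex_derive_C_derivative f (cos t, sin t) (f_hol (cos t, sin t) (arc_upper t Ht))) as [l Hl].
  apply C_derivative_pair in Hl. destruct Hl as [H _].
  apply (@ex_derive_continuous R_AbsRing R_NormedModule). eexists.
  apply is_derive_Reals. unfold g.
  apply (derivable_pt_lim_comp_2d (fun u v => Re (f (u, v))) cos sin); [exact H| |].
  - apply derivable_pt_lim_cos.
  - apply derivable_pt_lim_sin.
Qed.

Section Primitive.

Variables (w w' : R) (U : R -> R -> R).
Hypothesis U_prim : forall x y, 0 < y ->
  differentiable_pt_lim U x y (Re (cycle_form f w w' (x, y))) (- Im (cycle_form f w w' (x, y))).

Let V (z : C) : R := U (Re z) (Im z).

Lemma is_derive_primitive_curve (p q : R -> R) (t p' q' : R) : 0 < q t ->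
  is_derive p t p' -> is_derive q t q' ->
  is_derive (fun s => U (p s) (q s)) t (Re (cycle_form f w w' (p t, q t) * (p', q'))).
Proof.
  intros Hq Hp' Hq'. apply is_derive_Reals. apply is_derive_Reals in Hp'. apply is_derive_Reals in Hq'.
  assert (H := derivable_pt_lim_comp_2d U p q t _ _ _ _ (U_prim _ _ Hq) Hp' Hq').
  replace (Re _) with (Re (cycle_form f w w' (p t, q t)) * p' + - Im (cycle_form f w w' (p t, q t)) * q');
    [exact H|].
  unfold Cmult. simpl. unfold Re, Im. ring.
Qed.

(** The chain rule supplies the factor (c z + d)^-2 that [cycle_form_moebius] asks for; this is how
    a piece of the path is moved back by A. *)
Lemma is_derive_primitive_moebius A u u' (p q : R -> R) (t p' q' : R) : SL2Z A ->
  moebius_rel A u w -> moebius_rel A u' w' -> 0 < q t -> is_derive p t p' -> is_derive q t q' ->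
  is_derive (fun s => V (moebius_C A (p s, q s))) t (Re (cycle_form f u u' (p t, q t) * (p', q'))).
Proof.
  intros HA Hu Hu' Hq Hp' Hq'.
  destruct (is_derive_moebius_C A p q t p' q' HA Hq Hp' Hq') as [H1 H2].
  assert (Hz : upper_half_plane (p t, q t)) by exact Hq.
  assert (Hup := moebius_C_upper A (p t, q t) HA Hz).
  assert (H := is_derive_primitive_curve _ _ t _ _ Hup H1 H2). unfold V.
  rewrite <- (cycle_form_moebius f A u u' w w' (p t, q t) f_inv HA Hu Hu' Hz).
  replace (_ * (p', q'))%C with
    (cycle_form f w w' (moebius_C A (p t, q t)) * ((p', q') * / ((Zc (m21 A) * (p t, q t) + Zc (m22 A)) *
       (Zc (m21 A) * (p t, q t) + Zc (m22 A)))))%C by ring.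
  assert (HM : forall z : C, (Re z, Im z) = z) by (intros []; reflexivity).
  rewrite !HM in H. exact H.
Qed.

(** A fixes both roots, so z -> V (A z) and V have the same derivative along any segment; their
    difference is the period, whatever the base point. *)
Lemma primitive_moebius_cocycle A z1 z2 : SL2Z A -> moebius_rel A w w -> moebius_rel A w' w' ->
  upper_half_plane z1 -> upper_half_plane z2 ->
  V (moebius_C A z2) - V z2 = V (moebius_C A z1) - V z1.
Proof.
  intros HA Hw Hw' H1 H2. destruct z1 as [x1 y1], z2 as [x2 y2].
  unfold upper_half_plane in *. simpl in H1, H2.
  set (p := fun s => x1 + s * (x2 - x1)). set (q := fun s => y1 + s * (y2 - y1)).
  assert (Hder : forall t, 0 <= t <= 1 ->
    is_derive (fun s => V (moebius_C A (p s, q s)) - U (p s) (q s)) t 0).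
  { intros t Ht.
    assert (Hq : 0 < q t) by (unfold q; nra).
    assert (Hp' : is_derive p t (x2 - x1)) by (unfold p; auto_derive; [easy|ring]).
    assert (Hq' : is_derive q t (y2 - y1)) by (unfold q; auto_derive; [easy|ring]).
    assert (D := @is_derive_minus R_AbsRing R_NormedModule _ _ t _ _
      (is_derive_primitive_moebius A w w' p q t _ _ HA Hw Hw' Hq Hp' Hq')
      (is_derive_primitive_curve p q t _ _ Hq Hp' Hq')).
    rewrite minus_eq_zero in D. exact D. }
  assert (E := eq_is_derive (V := R_NormedModule) _ 0 1 Hder Rlt_0_1).
  cbv beta in E. unfold p, q in E.
  rewrite !Rmult_0_l, !Rmult_1_l, !Rplus_0_r in E.
  replace (x1 + (x2 - x1)) with x2 in E by ring. replace (y1 + (y2 - y1)) with y2 in E by ring.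
  symmetry. exact E.
Qed.

(** [(- sin t, cos t)] is the tangent i z of the arc. Partial fractions give (u - u') / ((z - u)(z -
    u')) = 1 / (z - u) - 1 / (z - u'), and the real value f(z) factors out. *)
Lemma arc_form_real u u' t : PI / 3 <= t <= 2 * PI / 3 -> u < 0 -> 0 < u' ->
  Re (cycle_form f u u' (cos t, sin t) * ((- sin t)%R, cos t)) =
  - (g t * arc_kernel 1 u' t + g t * arc_kernel (-1) (- u) t).
Proof.
  intros Ht Hu Hu'. destruct (f_arc t Ht) as [Him _].
  assert (Hs := arc_upper t Ht).
  assert (Hcs : cos t * cos t + sin t * sin t = 1).
  { generalize (sin2_cos2 t). unfold Rsqr. lra. }
  assert (Zu := sub_real_neq0 (cos t, sin t) u Hs). assert (Zu' := sub_real_neq0 (cos t, sin t) u' Hs).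
  assert (E : (cycle_form f u u' (cos t, sin t) * ((- sin t)%R, cos t))%C =
    (f (cos t, sin t) * (((- sin t)%R, cos t) * / ((cos t, sin t) - RtoC u)
       - ((- sin t)%R, cos t) * / ((cos t, sin t) - RtoC u')))%C).
  { unfold cycle_form. rewrite RtoC_minus. field. auto. }
  rewrite E.
  assert (Ef : f (cos t, sin t) = RtoC (g t)) by (apply Re_Im_eq; trivial).
  rewrite Ef.
  assert (Du : forall r, (cos t - r) * (cos t - r) + sin t * sin t = 1 - 2 * r * cos t + r * r).
  { intros r. rewrite <- Hcs at 1. ring. }
  assert (Dp : forall r, 0 < 1 - 2 * r * cos t + r * r).
  { intros r. rewrite <- Du. generalize (Rle_0_sqr (cos t - r)). unfold Rsqr. nra. }
  assert (Hk : forall r, Re (((- sin t)%R, cos t) * / ((cos t, sin t) - RtoC r)) =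
     r * sin t / (1 - 2 * r * cos t + r * r)).
  { intros r. rewrite <- Du. unfold Cmult, Cinv, Cminus, Cplus, Copp, RtoC, Re; simpl.
    specialize (Dp r). rewrite <- Du in Dp. field. lra. }
  assert (Hre : forall k z, Re (RtoC k * z) = k * Re z).
  { intros k z. unfold Cmult, RtoC, Re; simpl. ring. }
  assert (Hmin : forall z z', Re (z - z') = Re z - Re z') by (intros; reflexivity).
  rewrite Hre, Hmin, !Hk. unfold arc_kernel.
  replace (1 - 2 * - u * (-1 * cos t) + - u * - u) with (1 - 2 * u * cos t + u * u) by ring.
  replace (1 - 2 * u' * (1 * cos t) + u' * u') with (1 - 2 * u' * cos t + u' * u') by ring.
  field. split; apply Rgt_not_eq, Dp.
Qed.

Let rho : C := (cos (2 * PI / 3), sin (2 * PI / 3)).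

Lemma letter_rho s : moebius_C (letter_mat s) rho = (cos (PI / 3), sin (PI / 3)).
Proof.
  unfold rho. replace (2 * PI / 3) with (2 * (PI / 3)) by field.
  rewrite cos_2PI3, sin_2PI3, cos_PI3, sin_PI3.
  assert (H3 : sqrt 3 * sqrt 3 = 3) by (apply sqrt_sqrt; lra).
  set (r := sqrt 3) in *.
  destruct (moebius_C_Re_Im (letter_mat s) (-1 / 2) (r / 2) (SL2Z_letter s)) as [E1 E2].
  apply Re_Im_eq; [rewrite E1|rewrite E2]; destruct s; simpl.
  - field.
  - replace ((1 * (-1 / 2) + 1) * (1 * (-1 / 2) + 1) + 1 * (r / 2) * (1 * (r / 2))) with 1
      by (transitivity (1 / 4 + r * r / 4); [rewrite H3|]; field).
    transitivity (- 1 / 4 + r * r / 4); [field|rewrite H3; field].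
  - field.
  - replace ((1 * (-1 / 2) + 1) * (1 * (-1 / 2) + 1) + 1 * (r / 2) * (1 * (r / 2))) with 1
      by (transitivity (1 / 4 + r * r / 4); [rewrite H3|]; field).
    field.
Qed.

(** The step runs along the image of the arc under A from angle 2 pi / 3 down to pi / 3; the
    reversed orientation absorbs the minus sign of [arc_form_real]. *)
Lemma primitive_letter_step A s u u' : SL2Z A -> moebius_rel A u w -> moebius_rel A u' w' ->
  u < 0 -> 0 < u' ->
  V (moebius_C (mat_mul A (letter_mat s)) rho) - V (moebius_C A rho) =
  arc_integral g 1 u' + arc_integral g (-1) (- u).
Proof.
  intros HA Hu Hu' Hu0 Hu0'.
  assert (HPI := PI_RGT_0).
  assert (Hrho : upper_half_plane rho) by (apply (arc_upper (2 * PI / 3)); lra).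
  rewrite moebius_C_mul, letter_rho by (trivial; apply SL2Z_letter).
  assert (Hle := PI3_le_2PI3).
  set (h := fun t => g t * arc_kernel 1 u' t + g t * arc_kernel (-1) (- u) t).
  assert (H : is_RInt (fun t => - h t) (PI / 3) (2 * PI / 3)
    (minus (V (moebius_C A (cos (2 * PI / 3), sin (2 * PI / 3)))) (V (moebius_C A (cos (PI / 3), sin (PI / 3)))))).
  { apply (is_RInt_derive (V := R_CompleteNormedModule) (fun t => V (moebius_C A (cos t, sin t)))).
    - intros t Ht. rewrite Rmin_left, Rmax_right in Ht by trivial.
      unfold h. rewrite <- arc_form_real by trivial.
      apply is_derive_primitive_moebius; trivial.
      + now apply arc_upper.
      + apply is_derive_Reals, derivable_pt_lim_cos.
      + apply is_derive_Reals, derivable_pt_lim_sin.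
    - intros t Ht. rewrite Rmin_left, Rmax_right in Ht by trivial.
      apply (continuous_opp (V := R_NormedModule)). apply (continuous_plus (V := R_NormedModule));
        apply (continuous_mult (K := R_AbsRing)); try (now apply arc_values_continuous);
        apply arc_kernel_continuous; trivial; try lra; auto. }
  apply (is_RInt_unique (V := R_CompleteNormedModule)) in H.
  rewrite (RInt_opp (V := R_CompleteNormedModule)) in H.
  2:{ apply (@ex_RInt_plus R_NormedModule); apply ex_RInt_arc_integrand; try apply arc_values_continuous; auto; lra. }
  unfold h in H. rewrite (RInt_plus (V := R_CompleteNormedModule)) in H.
  - unfold minus, opp, plus in H; simpl in H. unfold arc_integral. fold rho in H. lra.
  - apply ex_RInt_arc_integrand; try apply arc_values_continuous; auto; lra.
  - apply ex_RInt_arc_integrand; try apply arc_values_continuous; auto; lra.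
Qed.

Lemma moebius_rel_letter A s u u0 r : moebius_rel A u r -> SL2Z A ->
  u = letter_act s u0 -> u0 + 1 <> 0 \/ s = true -> moebius_rel (mat_mul A (letter_mat s)) u0 r.
Proof.
  intros H HA -> Hu0. unfold moebius_rel in *. unfold mat_mul.
  destruct s; cbn [letter_mat letter_act mat_T mat_V m11 m12 m21 m22] in *;
    rewrite !plus_IZR, !mult_IZR.
  - lra.
  - destruct Hu0 as [Hu0|]; [|discriminate]. apply (f_equal (Rmult (u0 + 1))) in H.
    replace ((u0 + 1) * (r * (IZR (m21 A) * (u0 / (u0 + 1)) + IZR (m22 A)))) with
      (r * (IZR (m21 A) * u0 + IZR (m22 A) * (u0 + 1))) in H by (field; trivial).
    replace ((u0 + 1) * (IZR (m11 A) * (u0 / (u0 + 1)) + IZR (m12 A))) with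
      (IZR (m11 A) * u0 + IZR (m12 A) * (u0 + 1)) in H by (field; trivial).
    lra.
Qed.

(** A is the prefix already traversed, with -y = A^-1 w and [word_act l x] = A^-1 w'. Keeping A
    general lets the induction multiply it by the next letter while w, w' and the primitive stay
    fixed. *)
Lemma primitive_word l : forall A x y, SL2Z A -> 0 < x -> 0 < y ->
  moebius_rel A (- y) w -> moebius_rel A (word_act l x) w' ->
  V (moebius_C (mat_mul A (word_mat l)) rho) - V (moebius_C A rho) =
  forward_sum (arc_integral g 1) l x + backward_sum (arc_integral g (-1)) l y.
Proof.
  induction l as [|s l IH]; intros A x y HA Hx Hy Hw Hw'.
  - simpl. rewrite mat_mul_id_r. ring.
  - assert (Hl := word_act_gt0 l x Hx).
    change (word_mat (s :: l)) with (mat_mul (letter_mat s) (word_mat l)).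
    rewrite mat_mul_assoc. cbn [forward_sum backward_sum].
    assert (HAs := SL2Z_mul A _ HA (SL2Z_letter s)).
    assert (Hsl := word_act_gt0 (s :: l) x Hx).
    assert (Hstep := primitive_letter_step A s _ _ HA Hw Hw' ltac:(lra) Hsl).
    rewrite Ropp_involutive in Hstep.
    assert (Hrest := IH (mat_mul A (letter_mat s)) x (letter_act s y) HAs Hx (letter_act_gt0 s y Hy)).
    (* The inverse letter sends -y to [- letter_act s y]. *)
    assert (Hw1 : moebius_rel (mat_mul A (letter_mat s)) (- letter_act s y) w).
    { apply moebius_rel_letter with (- y); trivial; destruct s; simpl; auto; [ring|field; lra|left].
      replace (- (y / (y + 1)) + 1) with (/ (y + 1)) by (field; lra).
      apply Rinv_neq_0_compat. lra. }
    assert (Hw2 : moebius_rel (mat_mul A (letter_mat s)) (word_act l x) w').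
    { apply moebius_rel_letter with (word_act (s :: l) x); trivial. left. lra. }
    specialize (Hrest Hw1 Hw2). lra.
Qed.

End Primitive.
End CyclePeriods.

(** * The form of a hyperbolic word *)

Lemma Derive_moebius_R A x : SL2Z A -> IZR (m21 A) * x + IZR (m22 A) <> 0 ->
  Derive (moebius_R A) x = / ((IZR (m21 A) * x + IZR (m22 A)) * (IZR (m21 A) * x + IZR (m22 A))).
Proof.
  intros HA Hne. assert (Hdet := SL2Z_det_R A HA). apply is_derive_unique.
  unfold moebius_R. auto_derive; trivial.
  transitivity ((IZR (m11 A) * IZR (m22 A) - IZR (m12 A) * IZR (m21 A)) *
     / ((IZR (m21 A) * x + IZR (m22 A)) * (IZR (m21 A) * x + IZR (m22 A)))).
  - field. trivial.
  - rewrite Hdet. ring.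
Qed.

Lemma moebius_P1_fixed A w : moebius_P1 A (P1_fin w) = P1_fin w <->
  IZR (m21 A) * w + IZR (m22 A) <> 0 /\ moebius_rel A w w.
Proof.
  unfold moebius_P1, moebius_rel, moebius_R. destruct (Req_EM_T _ 0) as [H|H]; split.
  - discriminate.
  - tauto.
  - intros E. injection E as E. split; trivial. rewrite <- E at 1. field. trivial.
  - intros [_ E]. f_equal. rewrite <- E. field. trivial.
Qed.

Lemma primitive_multiple (a b c : Z) : (0 < a)%Z ->
  exists g a' b' c', (0 < g)%Z /\ a = (g * a')%Z /\ b = (g * b')%Z /\ c = (g * c')%Z /\
    Z.gcd (Z.gcd a' b') c' = 1%Z.
Proof.
  intros Ha. set (g := Z.gcd (Z.gcd a b) c).
  assert (Hg0 : (0 <= g)%Z) by apply Z.gcd_nonneg.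
  assert (Dab : (g | Z.gcd a b)%Z) by apply Z.gcd_divide_l.
  destruct (Z.divide_trans _ _ _ Dab (Z.gcd_divide_l a b)) as [a' Ea].
  destruct (Z.divide_trans _ _ _ Dab (Z.gcd_divide_r a b)) as [b' Eb].
  destruct (Z.gcd_divide_r (Z.gcd a b) c : (g | c)%Z) as [c' Ec].
  assert (Hg : (0 < g)%Z) by (destruct (Z.eq_dec g 0) as [E|E]; [rewrite E in Ea|]; lia).
  exists g, a', b', c'. repeat split; try lia.
  assert (E : g = (g * Z.gcd (Z.gcd a' b') c')%Z).
  { unfold g at 1. rewrite Ea, Eb, Ec, !(Z.mul_comm _ g).
    rewrite !Z.gcd_mul_mono_l, !(Z.abs_eq g) by lia.
    rewrite Z.gcd_mul_mono_l, (Z.abs_eq g) by lia. reflexivity. }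
  nia.
Qed.

Section HyperbolicWord.

Variable A : mat2.
Hypothesis A_SL2 : SL2Z A.
Hypothesis A_pos : (1 <= m11 A /\ 1 <= m12 A /\ 1 <= m21 A /\ 1 <= m22 A)%Z.

Let a := IZR (m11 A).
Let b := IZR (m12 A).
Let c := IZR (m21 A).
Let d := IZR (m22 A).

Lemma positive_entries_R : 1 <= a /\ 1 <= b /\ 1 <= c /\ 1 <= d /\ a * d - b * c = 1.
Proof.
  destruct A_pos as (H1 & H2 & H3 & H4). apply IZR_le in H1, H2, H3, H4.
  repeat split; trivial. now apply SL2Z_det_R.
Qed.

(** At the roots r of c r^2 + (d - a) r - b the values c r + d are the eigenvalues of A, with
    product 1, and the derivative of A is 1 / (c r + d)^2. The smaller eigenvalue thus belongs to
    the repelling point w, and w < w' forces a negative leading coefficient. *)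
Lemma is_form_of_exists : exists Q, is_form_of A Q.
Proof.
  destruct positive_entries_R as (Ha & Hb & Hc & Hd & Hdet).
  assert (Ht : 0 < (a + d) * (a + d) - 4).
  { assert (0 <= (a - d) * (a - d)) by apply Rle_0_sqr. nra. }
  set (s := sqrt ((a + d) * (a + d) - 4)).
  assert (Hs : 0 < s) by now apply sqrt_lt_R0.
  assert (Hss : s * s = (a + d) * (a + d) - 4) by (apply sqrt_sqrt; lra).
  set (w := (a - d - s) / (2 * c)). set (w' := (a - d + s) / (2 * c)).
  assert (Ew : c * w + d = (a + d - s) / 2) by (unfold w; field; lra).
  assert (Ew' : c * w' + d = (a + d + s) / 2) by (unfold w'; field; lra).
  assert (Hst : s < a + d) by nra.
  assert (Hroot : forall r, r = w \/ r = w' -> c * (r * r) + (d - a) * r - b = 0).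
  { assert (Hb' : b = (a * d - 1) / c) by (apply (Rmult_eq_reg_r c); [field_simplify; lra|lra]).
    intros r Hr. apply (Rmult_eq_reg_l (4 * c)); [|lra]. rewrite Rmult_0_r.
    transitivity (s * s - ((a + d) * (a + d) - 4)); [|lra].
    rewrite Hb'. destruct Hr as [-> | ->]; unfold w, w'; field; lra. }
  assert (Hrel : forall r, r = w \/ r = w' -> moebius_rel A r r).
  { intros r Hr. specialize (Hroot r Hr). unfold moebius_rel. fold a b c d. lra. }
  destruct (primitive_multiple (m21 A) (m22 A - m11 A) (m12 A)) as (g & c1 & e1 & b1 & Hg & Ec & Ee & Eb & Hgcd);
    [lia|].
  exists (QForm (- c1) (- e1) b1), w, w'.
  assert (Hg' := IZR_lt _ _ Hg).
  apply (f_equal IZR) in Ec, Ee, Eb. rewrite mult_IZR in Ec, Ee, Eb. rewrite minus_IZR in Ee.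
  fold a b c d in Ec, Ee, Eb.
  assert (Hq : forall r, r = w \/ r = w' -> qform_R (QForm (- c1) (- e1) b1) r 1 = 0).
  { intros r Hr. specialize (Hroot r Hr). rewrite Ec, Ee, Eb in Hroot.
    unfold qform_R. simpl. rewrite !opp_IZR.
    apply (Rmult_eq_reg_l (IZR g)); [|lra]. rewrite Rmult_0_r. lra. }
  assert (Hprod : (a + d - s) / 2 * ((a + d + s) / 2) = 1) by (field_simplify; lra).
  repeat split.
  - apply moebius_P1_fixed. fold c d. split; [rewrite Ew; lra|auto].
  - rewrite Derive_moebius_R by (trivial; fold c d; rewrite Ew; lra).
    fold c d. rewrite Ew. rewrite Rabs_inv, Rabs_pos_eq by nra.
    rewrite <- Rinv_1 at 1. apply Rinv_lt_contravar; nra.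
  - apply moebius_P1_fixed. fold c d. split; [rewrite Ew'; lra|auto].
  - rewrite Derive_moebius_R by (trivial; fold c d; rewrite Ew'; lra).
    fold c d. rewrite Ew'. rewrite Rabs_inv, Rabs_pos_eq by nra.
    rewrite <- Rinv_1. apply Rinv_lt_contravar; nra.
  - unfold primitive_form. simpl. now rewrite Z.gcd_opp_l, Z.gcd_opp_r.
  - auto.
  - auto.
  - simpl. rewrite opp_IZR. assert (0 < IZR c1) by nra. rewrite !sign_eq_m1; trivial; [|lra].
    unfold w, w'. replace ((a - d - s) / (2 * c) - (a - d + s) / (2 * c)) with (- (s / c)) by (field; lra).
    assert (0 < s / c) by (apply Rdiv_lt_0_compat; lra). lra.
Qed.

(** The form is known only through its specification. A root w >= 0 would give c w + d >= 1 and so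
    would not repel; the product -b / c of the roots then makes w' positive. *)
Lemma form_of_kernel : exists w w', w < 0 /\ 0 < w' /\ moebius_rel A w w /\ moebius_rel A w' w' /\
  forall tau, upper_half_plane tau ->
    (RtoC (sqrt (IZR (qdisc (form_of A)))) / qform_C (form_of A) tau (RtoC 1))%C =
    (RtoC (w - w') * (/ (tau - RtoC w) * / (tau - RtoC w')))%C.
Proof.
  destruct positive_entries_R as (Ha & Hb & Hc & Hd & Hdet).
  assert (Hspec : is_form_of A (form_of A)) by (unfold form_of; apply epsilon_spec, is_form_of_exists).
  set (Q := form_of A) in *. destruct Hspec as (w & w' & [Fw Dw] & [Fw' Dw'] & _ & Qw & Qw' & Hsg).
  apply moebius_P1_fixed in Fw, Fw'. destruct Fw as [Nw Rw], Fw' as [Nw' Rw'].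
  rewrite Derive_moebius_R in Dw, Dw' by trivial.
  exists w, w'. fold c d in Nw, Nw', Dw, Dw'.
  assert (Hw : w < 0).
  { apply Rnot_le_lt. intros Hw. assert (1 <= c * w + d) by nra.
    rewrite Rabs_inv, Rabs_pos_eq in Dw by nra.
    assert (/ ((c * w + d) * (c * w + d)) <= / 1) by (apply Rinv_le_contravar; nra).
    rewrite Rinv_1 in *. lra. }
  assert (Hne : w <> w') by (intros E; rewrite E in Dw; lra).
  assert (Ew : w * (c * w + d) = a * w + b) by exact Rw.
  assert (Ew' : w' * (c * w' + d) = a * w' + b) by exact Rw'.
  assert (Hsum : c * (w + w') = a - d).
  { apply (Rmult_eq_reg_l (w - w')); [|lra]. lra. }
  assert (Hprod : c * (w * w') = - b).
  { replace (c * (w * w')) with (c * (w + w') * w - c * (w * w)) by ring. rewrite Hsum. lra. }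
  assert (Hw' : 0 < w').
  { apply Rnot_le_lt. intros H. assert (0 <= c * (w * w')) by (apply Rmult_le_pos; nra). lra. }
  repeat split; trivial. intros tau Htau.
  unfold qform_R in Qw, Qw'.
  set (qa' := IZR (qa Q)) in *. set (qb' := IZR (qb Q)) in *. set (qc' := IZR (qc Q)) in *.
  assert (Hqa : qa' < 0).
  { apply Rnot_le_lt. intros H. rewrite (sign_eq_m1 (w - w')) in Hsg by lra.
    apply sign_le in H. rewrite sign_0 in H. lra. }
  assert (Hqb : qb' = - qa' * (w + w')) by (apply (Rmult_eq_reg_l (w - w')); lra).
  assert (Hqc : qc' = qa' * (w * w')) by (rewrite Hqb in Qw; lra).
  (* Both factors are negative, because the leading coefficient has the sign of w - w'; so the
     square root of the discriminant is their product. *)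
  assert (Hsq : sqrt (IZR (qdisc Q)) = qa' * (w - w')).
  { unfold qdisc. rewrite minus_IZR, !mult_IZR. fold qa' qb' qc'.
    replace (qb' * qb' - 4 * qa' * qc') with ((qa' * (w - w')) * (qa' * (w - w'))) by (rewrite Hqb, Hqc; ring).
    apply sqrt_square. nra. }
  rewrite Hsq. unfold qform_C, Zc. fold qa' qb' qc'. rewrite Hqb, Hqc.
  rewrite !RtoC_mult, !RtoC_plus, !RtoC_opp, !RtoC_minus.
  assert (Zw := sub_real_neq0 tau w Htau). assert (Zw' := sub_real_neq0 tau w' Htau).
  assert (Cq : RtoC qa' <> 0%C) by (intros E; apply RtoC_inj in E; lra).
  replace (RtoC qa' * (tau * tau) + - RtoC qa' * (RtoC w + RtoC w') * (tau * 1) +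
    RtoC qa' * (RtoC w * RtoC w') * (1 * 1))%C with
    (RtoC qa' * ((tau - RtoC w) * (tau - RtoC w')))%C by ring.
  field. auto.
Qed.

End HyperbolicWord.

Section CycleIntegral.

Variable f : C -> C.
Hypothesis f_hol : holomorphic_on upper_half_plane f.
Hypothesis f_inv : forall A z, SL2Z A -> upper_half_plane z -> f (moebius_C A z) = f z.
Hypothesis f_arc : forall t, PI / 3 <= t <= 2 * PI / 3 ->
  Im (f (cos t, sin t)) = 0 /\ 0 <= Re (f (cos t, sin t)).

Lemma holomorphic_pair_continuous_curve P Q (p q : R -> R) t p' q' : holomorphic_pair P Q ->
  0 < q t -> is_derive p t p' -> is_derive q t q' ->
  continuous (fun s => P (p s) (q s)) t /\ continuous (fun s => Q (p s) (q s)) t.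
Proof.
  intros H Hq Hp' Hq'. destruct (H (p t) (q t) Hq) as (al & be & HP & HQ).
  apply is_derive_Reals in Hp'. apply is_derive_Reals in Hq'.
  split; apply (@ex_derive_continuous R_AbsRing R_NormedModule); eexists; apply is_derive_Reals.
  - exact (derivable_pt_lim_comp_2d P p q t _ _ _ _ HP Hp' Hq').
  - exact (derivable_pt_lim_comp_2d Q p q t _ _ _ _ HQ Hp' Hq').
Qed.

Lemma Re_segment_integral w w' U F z1 z2 :
  (forall x y, 0 < y ->
    differentiable_pt_lim U x y (Re (cycle_form f w w' (x, y))) (- Im (cycle_form f w w' (x, y)))) ->
  (forall z, upper_half_plane z -> F z = cycle_form f w w' z) ->
  upper_half_plane z1 -> upper_half_plane z2 ->
  Re (segment_integral F z1 z2) = U (Re z2) (Im z2) - U (Re z1) (Im z1).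
Proof.
  intros HU HF H1 H2. destruct z1 as [x1 y1], z2 as [x2 y2].
  unfold upper_half_plane in H1, H2. simpl in H1, H2.
  set (p := fun s => x1 + s * (x2 - x1)). set (q := fun s => y1 + s * (y2 - y1)).
  assert (Hq : forall s, 0 <= s <= 1 -> 0 < q s) by (intros s Hs; unfold q; nra).
  assert (Hp' : forall t, is_derive p t (x2 - x1)) by (intros t; unfold p; auto_derive; [easy|ring]).
  assert (Hq' : forall t, is_derive q t (y2 - y1)) by (intros t; unfold q; auto_derive; [easy|ring]).
  set (v := ((x2 - x1)%R, (y2 - y1)%R) : C).
  set (h := fun s => (cycle_form f w w' (p s, q s) * v)%C).
  assert (Hhol := cycle_form_holomorphic f w w' f_hol).
  assert (Hcont : forall s, 0 <= s <= 1 ->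
    continuous (fun s => Re (h s)) s /\ continuous (fun s => Im (h s)) s).
  { intros s Hs.
    destruct (holomorphic_pair_continuous_curve _ _ p q s _ _ Hhol (Hq s Hs) (Hp' s) (Hq' s)) as [C1 C2].
    cbv beta in C1, C2. split.
    - apply (continuous_minus (V := R_NormedModule));
        (apply (continuous_mult (K := R_AbsRing)); [assumption|apply continuous_const]).
    - apply (continuous_plus (V := R_NormedModule));
        (apply (continuous_mult (K := R_AbsRing)); [assumption|apply continuous_const]). }
  assert (Hre : is_RInt (fun s => Re (h s)) 0 1 (U x2 y2 - U x1 y1)).
  { replace (U x2 y2 - U x1 y1) with (minus (U (p 1) (q 1)) (U (p 0) (q 0))).
    2:{ unfold p, q. rewrite !Rmult_0_l, !Rmult_1_l, !Rplus_0_r.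
        replace (x1 + (x2 - x1)) with x2 by ring. replace (y1 + (y2 - y1)) with y2 by ring. reflexivity. }
    apply (is_RInt_derive (V := R_CompleteNormedModule) (fun s => U (p s) (q s))).
    - intros s Hs. rewrite Rmin_left, Rmax_right in Hs by lra.
      apply (is_derive_primitive_curve f w w' U HU); auto.
    - intros s Hs. rewrite Rmin_left, Rmax_right in Hs by lra. now apply Hcont. }
  (* The complex integral is built from both components, so the imaginary part must be shown
     integrable before the real component can be read off. *)
  assert (Him : ex_RInt (fun s => Im (h s)) 0 1).
  { apply (@ex_RInt_continuous R_CompleteNormedModule). intros s Hs.
    rewrite Rmin_left, Rmax_right in Hs by lra. now apply Hcont. }
  destruct Him as [im Him].
  assert (Hh : @is_RInt C_R_NormedModule h 0 1 (U x2 y2 - U x1 y1, im)).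
  { apply (@is_RInt_fct_extend_pair R_NormedModule R_NormedModule); assumption. }
  unfold segment_integral.
  rewrite (RInt_ext (V := C_R_CompleteNormedModule) _ h).
  - rewrite (is_RInt_unique (V := C_R_CompleteNormedModule) h 0 1 _ Hh). reflexivity.
  - intros s Hs. rewrite Rmin_left, Rmax_right in Hs by lra.
    assert (E : ((x1, y1) + RtoC s * ((x2, y2) - (x1, y1)))%C = (p s, q s)).
    { unfold Cplus, Cmult, Cminus, Copp, RtoC, p, q; simpl. f_equal; ring. }
    rewrite E, HF; [reflexivity|]. apply Hq. lra.
Qed.

Lemma Re_cycle_integral_word tau0 l : upper_half_plane tau0 -> In true l -> In false l ->
  exists x y, 0 < x /\ 0 < y /\
  Re (cycle_integral f tau0 (word_mat l)) =
    forward_sum (arc_integral (fun t => Re (f (cos t, sin t))) 1) l x +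
    backward_sum (arc_integral (fun t => Re (f (cos t, sin t))) (-1)) l y.
Proof.
  intros Htau HT HV. set (A := word_mat l).
  assert (HA : SL2Z A) by apply SL2Z_word.
  assert (HApos : (1 <= m11 A /\ 1 <= m12 A /\ 1 <= m21 A /\ 1 <= m22 A)%Z).
  { assert (H := word_mat_entries l). cbv zeta in H. fold A in H.
    assert (H1 := word_mat_T_in l HT). assert (H2 := word_mat_V_in l HV). fold A in H1, H2. lia. }
  destruct (form_of_kernel A HA HApos) as (w & w' & Hw & Hw' & Rw & Rw' & HF).
  destruct (holomorphic_pair_primitive _ _ (cycle_form_holomorphic f w w' f_hol)) as [U HU].
  (* These are still the fixed points of A, up to sign; the replacement by 1 takes place in
     [word_sum_close]. *)
  exists w', (- w). split; [trivial|]. split; [lra|].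
  unfold cycle_integral.
  destruct (excluded_middle_informative (hyperbolic A)) as [_|Hn]; [|elim Hn; now apply hyperbolic_word].
  cbv zeta.
  rewrite (Re_segment_integral w w' U); trivial.
  - set (rho := (cos (2 * PI / 3), sin (2 * PI / 3)) : C).
    assert (HPI := PI_RGT_0).
    assert (Hrho : upper_half_plane rho) by (apply (arc_upper (2 * PI / 3)); lra).
    (* The period is the same from [tau0] and from [rho], and from [rho] it can be followed along
       the arcs. *)
    assert (E1 := primitive_moebius_cocycle f f_inv w w' U HU A rho tau0 HA Rw Rw' Hrho Htau).
    cbv zeta in E1. rewrite E1.
    assert (Hid : forall r, moebius_rel mat_id r r) by (intros r; unfold moebius_rel; simpl; ring).
    assert (Hfix : word_act l w' = w').
    { rewrite word_actE by lra. fold A.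
      assert (Dn := moebius_rel_denominator A w' w' HA Rw'). unfold moebius_rel in Rw'.
      unfold moebius_R. rewrite <- Rw'. field. exact Dn. }
    assert (E2 := primitive_word f f_hol f_inv f_arc w w' U HU l mat_id w' (- w)
      eq_refl Hw' ltac:(lra) ltac:(rewrite Ropp_involutive; apply Hid) ltac:(rewrite Hfix; apply Hid)).
    cbv zeta in E2. rewrite mat_mul_id_l, moebius_C_id in E2. exact E2.
  - intros z Hz. unfold cycle_form. rewrite <- HF by trivial. unfold Cdiv. ring.
  - now apply moebius_C_upper.
Qed.

End CycleIntegral.

Theorem theorem1p4 (f : C -> C)
  (Hmod : weakly_holomorphic_modular f)
  (Hnz : exists tau : C, upper_half_plane tau /\ f tau <> RtoC 0)
  (Harc : forall t : R, PI / 3 <= t <= 2 * PI / 3 ->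
     Im (f (C_exp (Ci * RtoC t)%C)) = 0 /\ 0 <= Re (f (C_exp (Ci * RtoC t)%C))) :
  exists Lambda : P1R -> R,
    (forall (tau0 : C) (x : R), upper_half_plane tau0 -> 0 < x ->
       limsup_cycle_integral f tau0 x = Finite (Lambda (P1_fin x))) /\
    (forall (A : mat2) (p : P1R), GL2Z A ->
       Lambda (moebius_P1 A p) = Lambda p) /\
    (forall p : P1R, P1_rational p -> Lambda p = 0).
Proof.
  destruct Hmod as (f_hol & f_inv & _).
  assert (f_arc : forall t, PI / 3 <= t <= 2 * PI / 3 ->
    Im (f (cos t, sin t)) = 0 /\ 0 <= Re (f (cos t, sin t))).
  { intros t Ht. rewrite <- C_exp_arc. now apply Harc. }
  set (g := fun t => Re (f (cos t, sin t))).
  set (phi := arc_integral g 1). set (psi := arc_integral g (-1)).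
  set (K := 16 * RInt g (PI / 3) (2 * PI / 3)).
  assert (g_cont := arc_values_continuous f f_hol : forall t, _ -> continuous g t).
  assert (g_ge0 : forall t, PI / 3 <= t <= 2 * PI / 3 -> 0 <= g t) by (intros t Ht; now apply f_arc).
  assert (HK : 0 <= K) by (unfold K; generalize (RInt_arc_ge0 g g_cont g_ge0); lra).
  assert (Hphi : arc_like K phi) by (apply arc_integral_arc_like; auto).
  assert (Hpsi : arc_like K psi) by (apply arc_integral_arc_like; auto).
  exists (exponent phi psi). split; [|split].
  - intros tau0 x Htau Hx. unfold limsup_cycle_integral.
    apply (limsup_farey_average K phi psi HK Hphi Hpsi); trivial.
    intros n l Hl HT HV. rewrite Hl.
    (* [u] and [v] vary with n, but the bound of [word_sum_close] is uniform in them. *)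
    destruct (Re_cycle_integral_word f f_hol f_inv f_arc tau0 l Htau HT HV) as (u & v & Hu & Hv & ->).
    apply word_sum_close; trivial; lra.
  - intros A p HA. now apply (exponent_moebius K).
  - apply exponent_rational.
Qed.
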